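(* Let $0<\alpha_0<\infty$ be fixed. Assume that the sequence of model collections satisfies $\mathcal{M}_n\subset\mathcal{M}_{n+1}$ for every $n$, that the sequence of positive numbers $(\lambda_n)_n$ is non-decreasing and satisfies $\lim_{n\to+\infty}n^{-1}\lambda_n=0$, and that there exist $n_0\in\mathbb{N}^*$ and two constants $0<\delta\le\frac12$ and $0<p<1$ such that for every $n\ge n_0$, $$\lambda_{2n}\le 2(1-\delta)\lambda_n,\qquad \sum_{m\in\mathcal{M}_n}e^{-\frac{(\sqrt{\lambda_n}-1)^2D_m}{2}}\le\sqrt{1-p},$$ and $$\lambda_{n_0}\ge\Upsilon(\delta,p,\alpha_0).$$ Then the penalized rule $\hat s_{\hat m}$ is such that for every $\alpha\in(0,\alpha_0]$ and every $R>0$ there exists $R'>0$ such that for every $s\in\mathbb{L}_2(\mathcal{D})$, $$\sup_n\left\{\rho_{n,\alpha}^{-2}\,\mathbb{E}\left[\|\hat s_{\hat m}-s\|^2\right]\right\}\le R^2\ \Longrightarrow\ \sup_n\left\{\rho_{n,\alpha}^{-2}\,Q(s,n)\right\}\le (R')^2.$$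
   Context: Gaussian white noise model: $\mathcal{D}\subset\mathbb{R}$, $s\in\mathbb{L}_2(\mathcal{D})$ is unknown, $\|\cdot\|$ is the $\mathbb{L}_2(\mathcal{D})$ norm, and for $n\in\mathbb{N}^*=\{1,2,\dots\}$ one observes, for all $u\in\mathbb{L}_2(\mathcal{D})$, $Y_n(u)=\int_{\mathcal{D}}u(t)s(t)\,dt+\frac{1}{\sqrt n}W_u$, where $(W_u)$ is a centered Gaussian process with $\mathbb{E}[W_uW_{u'}]=\int_{\mathcal{D}}u(t)u'(t)\,dt$. Models: $\Phi=(\varphi_i)_{i\in\mathcal{I}}$ is a countable family (dictionary) of functions of $\mathbb{L}_2(\mathcal{D})$. For each $n$, $\mathcal{M}_n$ is a collection of models $m=\mathrm{span}\{\varphi_i: i\in\mathcal{I}_m\}$ with $\mathcal{I}_m\subset\mathcal{I}$; $D_m$ is the dimension of $m$, and $s_m$ is the orthogonal projection of $s$ onto $m$. The estimator $\hat s_m$ minimizes $\gamma_n(u)=-2Y_n(u)+\|u\|^2$ over $u\in m$, i.e. $\hat s_m=\sum_{i=1}^{D_m}Y_n(e_i^m)e_i^m$ for any orthonormal basis $(e_i^m)$ of $m$. Given positive numbers $(\lambda_n)_n$, the penalty is $\mathrm{pen}_n(m)=\frac{\lambda_n}{n}D_m$, and $\hat m=\arg\min_{m\in\mathcal{M}_n}\{\gamma_n(\hat s_m)+\mathrm{pen}_n(m)\}$; $\hat s_{\hat m}$ is the model selection estimator (depending on $n$). Notation: $\rho_{n,\alpha}=\left(\frac{\lambda_n}{n}\right)^{\frac{\alpha}{1+2\alpha}}$;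 $Q(s,n)=\inf_{m\in\mathcal{M}_n}\left\{\|s_m-s\|^2+\frac{\lambda_n}{n}D_m\right\}$; $g(\delta,\alpha_0)=\inf_{\alpha\in(0,\alpha_0]}\inf_{x\in[\frac12,1-\delta]}\{x^{\frac{2\alpha}{2\alpha+1}}-x\}=(1-\delta)^{\frac{2\alpha_0}{2\alpha_0+1}}-1+\delta$; $\Upsilon(\delta,p,\alpha_0)=\frac{8}{p\,g(\delta,\alpha_0)}\left(\frac{16}{g(\delta,\alpha_0)}+1\right)$. *)

(* Defs.v *)
From HB Require Import structures.
From mathcomp Require Import all_boot all_order all_algebra.
From mathcomp Require Import all_classical all_reals all_analysis.

Set Implicit Arguments.
Unset Strict Implicit.
Unset Printing Implicit Defensive.

Import Order.TTheory GRing.Theory Num.Theory.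
Import numFieldNormedType.Exports.

Local Open Scope classical_set_scope.
Local Open Scope ring_scope.

Lemma one_le_two {R : realType} : (1 <= 2%:E :> \bar R)%E.
Proof. by rewrite lee_fin ler1n. Qed.

(* Elements of [LfunType mu _] are square-integrable functions, not classes.  Equality
   in the mathematical L2 is equality mu-almost everywhere, and the notions
   below are invariant under it. *)
Section L2.
Context {d} {X : measurableType d} {R : realType}.
Variable mu : {measure set X -> \bar R}.

Local Notation L2 := (LfunType mu (@one_le_two R)).

Definition inner (f g : L2) : R := \int[mu]_x (f x * g x).

Definition L2norm (f : L2) : R := fine ('N[mu]_2%:E[EFin \o f])%E.

(* Saturated under a.e. equality, so that two spans are equal as sets iff they
   are the same subspace of classes. *)
Definition lspan (A : set L2) : set L2 :=
  [set f : L2 | exists k (a : 'I_k -> R) (g : 'I_k -> L2),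
    (forall i, A (g i)) /\
    (f : X -> R) = (\sum_(i < k) a i *: g i : L2) %[ae mu]].

Definition lin_indep k (b : 'I_k -> L2) : Prop :=
  forall a : 'I_k -> R,
    ((\sum_(i < k) a i *: b i : L2) : X -> R) = cst 0 %[ae mu] ->
    forall i, a i = 0.

Definition is_basis k (b : 'I_k -> L2) (m : set L2) : Prop :=
  lin_indep b /\ lspan (range b) = m.

Definition has_dim (m : set L2) (k : nat) : Prop :=
  exists b : 'I_k -> L2, is_basis b m.

(* Default value 0 if [m] is not a finite-dimensional subspace. *)
Definition model_dim (m : set L2) : nat := xget 0%N [set k | has_dim m k].

Definition orthonormal_basis k (e : 'I_k -> L2) (m : set L2) : Prop :=
  (forall i j, inner (e i) (e j) = (i == j)%:R) /\ lspan (range e) = m.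

(* A representative of the orthogonal projection of [s] onto [m]. *)
Definition orth_proj (m : set L2) (s : L2) : L2 :=
  xget 0 [set q | m q /\ forall u, m u -> inner (s - q) u = 0].

Definition is_model {I : countType} (phi : I -> L2) (m : set L2) : Prop :=
  (exists J : set I, m = lspan (phi @` J)) /\ exists k, has_dim m k.

End L2.

Definition lebesgue_on {R : realType} (D : set R) (mD : measurable D) :
    {measure set (measurableTypeR R) -> \bar R} :=
  mrestr (@lebesgue_measure R) mD.

Notation L2 mu := (LfunType mu one_le_two).

Section white_noise.
Context {d} {X : measurableType d} {R : realType}.
Variable mu : {measure set X -> \bar R}.
Context {d'} {T : measurableType d'}.
Variable P : probability T R.

(* The degenerate case is separate because the library's [normal_prob m 0] is
   the uniform law on [0, 1], not the Dirac mass at [m]. *)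
Definition is_gaussian (Z : {RV P >-> R}) : Prop :=
  exists m sigma : R, 0 <= sigma /\
    forall A : set R, measurable A ->
      distribution P Z A =
        if sigma == 0 then \d_m A else normal_prob m sigma A.

Definition gaussian_process (W : L2 mu -> {RV P >-> R}) : Prop :=
  forall k (a : 'I_k -> R) (u : 'I_k -> L2 mu),
    is_gaussian (\sum_(i < k) a i *: W (u i)).

Definition white_noise (W : L2 mu -> {RV P >-> R}) : Prop :=
  [/\ gaussian_process W,
      forall u, ('E_P[W u] = 0)%E &
      forall u v, ('E_P[W u \* W v] = (inner u v)%:E)%E].

(* The sample path at [w] of the observed process Y_n. *)
Definition observation (W : L2 mu -> {RV P >-> R}) (s : L2 mu) (n : nat)
    (w : T) : L2 mu -> R :=
  fun u => inner u s + (Num.sqrt n%:R)^-1 * W u w.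

End white_noise.

Section model_selection.
Context {d} {X : measurableType d} {R : realType}.
Variable mu : {measure set X -> \bar R}.

(* An arbitrary version of Y_n is linear in u only up to null sets depending on
   u, so evaluating a sample path at a random point of a model is meaningless.
   On a model with orthonormal basis [e], Y_n is read through its version with
   linear paths, the one for which the minimizer of gamma_n over the model is
   [estimator y e].  It coincides with [y] on the model if [y] is
   linear there and invariant under a.e. equality. *)
Definition linear_version (y : L2 mu -> R) k (e : 'I_k -> L2 mu) : L2 mu -> R :=
  fun u => \sum_(i < k) inner u (e i) * y (e i).

Definition contrast (y : L2 mu -> R) (u : L2 mu) : R :=
  - 2 * y u + L2norm u ^+ 2.

Definition estimator (y : L2 mu -> R) k (e : 'I_k -> L2 mu) : L2 mu :=
  \sum_(i < k) y (e i) *: e i.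

Definition penalty (lambda : nat -> R) (n : nat) (m : set (L2 mu)) : R :=
  lambda n / n%:R * (model_dim m)%:R.

Definition criterion (lambda : nat -> R)
    (e : forall m : set (L2 mu), 'I_(model_dim m) -> L2 mu)
    (n : nat) (y : L2 mu -> R) (m : set (L2 mu)) : R :=
  contrast (linear_version y (e m)) (estimator y (e m)) + penalty lambda n m.

(* [mhat n y] is the model selected from the data [y]; as an estimator it is
   required to be measurable. *)
Definition selection_rule {d'} {T : measurableType d'} (P : probability T R)
    (W : L2 mu -> {RV P >-> R}) (M : nat -> set (set (L2 mu)))
    (lambda : nat -> R) (e : forall m : set (L2 mu), 'I_(model_dim m) -> L2 mu)
    (mhat : nat -> (L2 mu -> R) -> set (L2 mu)) : Prop :=
  forall n : nat, (0 < n)%N ->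
    [/\ forall y, M n (mhat n y),
        forall s m, M n m ->
          measurable [set w | mhat n (observation W s n w) = m] &
        forall s, {ae P, forall w, forall m, M n m ->
          criterion lambda e n (observation W s n w)
            (mhat n (observation W s n w)) <=
          criterion lambda e n (observation W s n w) m}].

Definition selected_estimator
    (e : forall m : set (L2 mu), 'I_(model_dim m) -> L2 mu)
    (mhat : nat -> (L2 mu -> R) -> set (L2 mu)) (n : nat) (y : L2 mu -> R) :
    L2 mu :=
  estimator y (e (mhat n y)).

Definition approx_error (lambda : nat -> R) (M : nat -> set (set (L2 mu)))
    (s : L2 mu) (n : nat) : \bar R :=
  ereal_inf [set (L2norm (orth_proj m s - s) ^+ 2
                  + lambda n / n%:R * (model_dim m)%:R)%:E | m in M n].

End model_selection.

Section constants.
Context {R : realType}.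

Definition rho (lambda : nat -> R) (n : nat) (alpha : R) : R :=
  (lambda n / n%:R) `^ (alpha / (1 + 2 * alpha)).

Definition g (delta alpha0 : R) : R :=
  inf [set inf [set x `^ (2 * alpha / (2 * alpha + 1)) - x
                 | x in `[2^-1, 1 - delta]]
       | alpha in `]0, alpha0]].

Definition Upsilon (delta p alpha0 : R) : R :=
  8 / (p * g delta alpha0) * (16 / g delta alpha0 + 1).

End constants.

(* Main.v *)
Require Import Defs.
From HB Require Import structures.
From mathcomp Require Import all_boot all_order all_algebra.
From mathcomp Require Import all_classical all_reals all_analysis.
From mathcomp Require Import finmap measurable_realfun ring lra.

Set Implicit Arguments.
Unset Strict Implicit.
Unset Printing Implicit Defensive.

Import Order.TTheory GRing.Theory Num.Theory.
Import numFieldNormedType.Exports.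

Local Open Scope classical_set_scope.
Local Open Scope ring_scope.

(** For a model m write b(m) for the squared distance of s to m, D(m) for its
    dimension, X(m) for the sum of the squares of the noise coordinates of m,
    and eps n for lambda n / n.  The loss of the estimator on m is exactly
    b(m) + X(m) / n.  So the risk bound controls the bias of the selected model
    and the quadratic noise on it, but says nothing directly about its
    dimension; the dimension is what the proof has to recover.

    Comparing the selected model m' with any m in the collection, the minimality
    of the criterion gives
      b(m') + eps D(m') <= b(m) + eps D(m) + (2 / sqrt n) (G(m') - G(m)) + X(m') / n
    where G is the noise integrated against the bias s_m - s, a centered
    Gaussian variable of variance b(m).  The weights exp(-(sqrt lambda - 1)^2 D / 2)
    sum to at most sqrt (1 - p) < 1, which leaves room for a union bound: with
    positive probability G(m') is controlled, simultaneously for all m', by a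
    small multiple of eps D(m') and a large multiple of b(m'); on the same
    outcome the loss is at most a constant times the risk ([good_outcome]).  One
    such outcome suffices, because b and D are deterministic functions of the
    model.  Hence a near-minimizer m at sample size n can be replaced by m' with
    b(m') = O(rho_n^2) and
      b(m') + eps D(m') <= (1 + theta) / (1 - theta) (b(m) + eps D(m)) + O(rho_n^2)
    for any fixed small theta ([refined_model]).

    At sample size 2n the same model costs b(m') + x eps_n D(m') with
    x = eps_(2n) / eps_n in [1/2, 1 - delta]: the bias is already small and the
    penalty is multiplied by x, whereas rho^2 is only multiplied by x^beta,
    beta = 2 alpha / (1 + 2 alpha) < 1.  As x^beta - x is bounded below
    ([powR_gap]), a bound C rho_n^2 propagates from n to 2n once C is large
    ([approximable_double]).  Other sample sizes lie within a factor 2 of a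
    dyadic one and M, lambda are monotone ([approximable_between]).

    The induction starts at n <= n0, where a bound that is uniform in s is
    needed.  There X(m') / n <= O(1), and a union bound over the events where
    X(m) is much smaller than D(m) turns this into a bound on D(m')
    ([initial_model]).  It needs P(X(m) <= c D(m)) <= exp(-kappa D(m)) for a
    prescribed kappa ([gaussian_small_ball]).  White noise is only given through
    the one-dimensional laws of its linear forms, so the Laplace transform of
    X(m) is computed without joint laws: exp(-tau^2 |w|^2 / 2) is the average of
    cos(xi . w) over a Gaussian xi, and one coordinate of xi is integrated at a
    time ([laplace_cos]).  This is where the Fourier transform of the normal law
    ([normal_cos]) is used. *)

(** * Inner product of square-integrable functions *)

Section inner_product.
Context {d} {X : measurableType d} {R : realType}.
Variable mu : {measure set X -> \bar R}.
Local Notation L2 := (LfunType mu (@one_le_two R)).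
Implicit Types f g h u : L2.

Lemma integrable_inner f g :
  mu.-integrable setT (EFin \o (fun x => f x * g x)).
Proof.
have := Lfun2_mul_Lfun1 (LfunP f) (LfunP g).
by move/Lfun1_integrable.
Qed.

Lemma innerC f g : inner f g = inner g f.
Proof. by apply: eq_Rintegral => x _; rewrite mulrC. Qed.

Lemma innerDl f g h : inner (f + g) h = inner f h + inner g h.
Proof.
rewrite /inner -RintegralD//; [|exact: integrable_inner..].
by apply: eq_Rintegral => x _ /=; rewrite mulrDl.
Qed.

Lemma innerZl a f h : inner (a *: f) h = a * inner f h.
Proof.
rewrite /inner -RintegralZl//; last exact: integrable_inner.
by apply: eq_Rintegral => x _ /=; rewrite mulrA.
Qed.

Lemma innerDr f g h : inner h (f + g) = inner h f + inner h g.
Proof. by rewrite innerC innerDl !(innerC h). Qed.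

Lemma innerZr a f h : inner h (a *: f) = a * inner h f.
Proof. by rewrite innerC innerZl !(innerC h). Qed.

Lemma inner0l h : inner 0 h = 0.
Proof. by rewrite -(scale0r 0) innerZl mul0r. Qed.

Lemma innerNl f h : inner (- f) h = - inner f h.
Proof. by rewrite -scaleN1r innerZl mulN1r. Qed.

Lemma innerBl f g h : inner (f - g) h = inner f h - inner g h.
Proof. by rewrite innerDl innerNl. Qed.

Lemma innerBr f g h : inner h (f - g) = inner h f - inner h g.
Proof. by rewrite innerC innerBl !(innerC h). Qed.

Lemma inner_suml k (u : 'I_k -> L2) h :
  inner (\sum_(i < k) u i) h = \sum_(i < k) inner (u i) h.
Proof.
apply: (big_ind2 (fun f r => inner f h = r)) => //; first exact: inner0l.
by move=> f r g s <- <-; rewrite innerDl.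
Qed.

Lemma inner_sumr k (u : 'I_k -> L2) h :
  inner h (\sum_(i < k) u i) = \sum_(i < k) inner h (u i).
Proof. by rewrite innerC inner_suml; apply: eq_bigr => i _; rewrite innerC. Qed.

Lemma inner_ge0 f : 0 <= inner f f.
Proof. by apply: Rintegral_ge0 => // x _; rewrite -expr2 sqr_ge0. Qed.

Lemma L2norm_sq f : L2norm f ^+ 2 = inner f f.
Proof.
have n2 : (2 : R) != 0 by rewrite pnatr_eq0.
have := poweR_Lnorm mu (EFin \o f) n2.
rewrite /= -finite_norm_fine poweR_EFin powR_mulrn; last first.
  by rewrite fine_ge0 // Lnorm_ge0.
rewrite /L2norm /inner /Rintegral => e.
apply: EFin_inj; rewrite e fineK; last first.
  by apply: integrable_fin_num => //; exact: integrable_inner.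
by apply: eq_integral => x _ /=; rewrite powR_mulrn// -normrX ger0_norm ?sqr_ge0 ?expr2.
Qed.

(** Spans are saturated under almost everywhere equality, so orthogonality to the
    generators of a model only passes to its elements through this invariance. *)
Lemma inner_ae_eqr f g h : (f : X -> R) = g %[ae mu] -> inner h f = inner h g.
Proof.
move=> fg; congr fine; apply: ae_eq_integral => //.
- by case/integrableP: (integrable_inner h f).
- by case/integrableP: (integrable_inner h g).
- by apply: filterS fg => x /= /[apply] ->.
Qed.

End inner_product.

(** * The normal law under translations and exponential tilting *)

Section normal_law.
Context {R : realType}.
Local Notation mu := (@lebesgue_measure R).
Local Notation RM := (measurableTypeR R).

(** The normal law is defined by its values on sets; integrals against it reduce to
    Lebesgue integrals by uniqueness of the Radon-Nikodym derivative. *)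
Lemma ge0_integral_normal_prob (m s : R) (f : R -> \bar R) :
  measurable_fun [set: R] f -> (forall x, 0 <= f x)%E ->
  (\int[normal_prob m s]_x f x = \int[mu]_x (f x * (normal_pdf m s x)%:E))%E.
Proof.
move=> mf f0.
have dom := normal_prob_dominates m s.
rewrite -(Radon_Nikodym_SigmaFinite.change_of_variables dom)//.
have intf := Radon_Nikodym_SigmaFinite.f_integrable dom.
apply: ae_eq_integral => //.
- by apply: emeasurable_funM => //; case/integrableP: intf.
- apply: emeasurable_funM => //; apply/measurable_EFinP.
  exact: measurable_normal_pdf.
- apply: ae_eqe_mul2l => /=.
  apply: integral_ae_eq => //=.
  + by apply/measurable_EFinP; exact: measurable_normal_pdf.
  + by move=> E _ mE; rewrite -Radon_Nikodym_SigmaFinite.f_integral.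
Qed.

Lemma lebesgue_measure_shift (h : R) (A : set RM) : measurable A ->
  pushforward mu (fun x : RM => x + h : RM) A = mu A.
Proof.
move=> mA; apply/esym/lebesgue_measure_unique => //=; first exact: measurable_funD.
move=> _ _ [[a b]] _ <-.
rewrite /pushforward.
have -> : +%R^~ h @^-1` `]a, b] = `]a - h, b - h]%classic.
  by apply/seteqP; split=> x /=; rewrite !in_itv/= ltrBlDr lerBrDr.
rewrite !lebesgue_measure_itv/= !lte_fin ltrD2r; case: ifP => // _.
by rewrite -!EFinB; congr EFin; ring.
Qed.

Lemma ge0_integral_shift (h : R) (f : R -> \bar R) :
  measurable_fun [set: R] f -> (forall x, 0 <= f x)%E ->
  (\int[mu]_x f (x + h)%R = \int[mu]_x f x)%E.
Proof.
move=> mf f0.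
transitivity (\int[pushforward mu (fun x : RM => (x + h)%R : RM)]_x f x)%E.
  rewrite ge0_integral_pushforward//=.
  exact: measurable_funD.
apply: eq_measure_integral => //=; first exact: measurable_funD.
by move=> ? A mA _; exact: lebesgue_measure_shift.
Qed.

Lemma normal_pdf_shift (m s h x : R) : s != 0 ->
  normal_pdf (m + h) s (x + h) = normal_pdf m s x.
Proof.
move=> s0; rewrite !normal_pdfE// /normal_fun.
by have -> : x + h - (m + h) = x - m by ring.
Qed.

Lemma measurable_expRM (a : R) :
  measurable_fun [set: R] (fun x => (expR (a * x))%:E).
Proof.
apply/measurable_EFinP; apply: (measurableT_comp (@measurable_expR R)).
exact: mulrl_measurable.
Qed.

(** Completing the square: tilting a normal density by an exponential only moves
    its mean. *)
Lemma expR_normal_pdf (m s a x : R) : s != 0 ->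
  expR (a * x) * normal_pdf m s x =
  expR (a * m + a ^+ 2 * s ^+ 2 / 2) * normal_pdf (m + a * s ^+ 2) s x.
Proof.
move=> s0; rewrite !normal_pdfE// /normal_fun.
rewrite ![expR _ * (normal_peak s * _)]mulrCA -!expRD.
by do 2!congr (_ _); field.
Qed.

Lemma ge0_integral_normal_probD (m s h : R) (f : R -> \bar R) : s != 0 ->
  measurable_fun [set: R] f -> (forall x, 0 <= f x)%E ->
  (\int[normal_prob (m + h) s]_x f x =
   \int[normal_prob m s]_x f (x + h)%R)%E.
Proof.
move=> s0 mf f0.
have mfh : measurable_fun [set: R] (fun x : R => f (x + h)).
  by apply: measurableT_comp => //; exact: measurable_funD.
rewrite (ge0_integral_normal_prob (m + h) s mf f0).
rewrite (ge0_integral_normal_prob m s mfh (fun x => f0 (x + h))).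
rewrite -(ge0_integral_shift h); last 2 first.
- apply: emeasurable_funM => //; apply/measurable_EFinP.
  exact: measurable_normal_pdf.
- by move=> x; rewrite mule_ge0// lee_fin normal_pdf_ge0.
by apply: eq_integral => x _; rewrite normal_pdf_shift.
Qed.

(** The Cameron-Martin formula on the line.  With f = 1 it is the moment generating
    function, and differentiating it in a gives the integration by parts formula. *)
Lemma ge0_integral_expR_normal_prob (m s a : R) (f : R -> \bar R) : s != 0 ->
  measurable_fun [set: R] f -> (forall x, 0 <= f x)%E ->
  (\int[normal_prob m s]_x ((expR (a * x))%:E * f x) =
   (expR (a * m + a ^+ 2 * s ^+ 2 / 2))%:E *
     \int[normal_prob m s]_x f (x + a * s ^+ 2)%R)%E.
Proof.
move=> s0 mf f0.
have me := measurable_expRM a.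
rewrite -ge0_integral_normal_probD//.
rewrite (ge0_integral_normal_prob (m + a * s ^+ 2) s mf f0).
rewrite (ge0_integral_normal_prob m s (emeasurable_funM me mf)); last first.
  by move=> x; rewrite mule_ge0// lee_fin expR_ge0.
rewrite -ge0_integralZl//.
- apply: eq_integral => x _.
  rewrite muleAC -EFinM expR_normal_pdf// EFinM -muleA; congr (_ * _)%E.
  by rewrite muleC.
- apply: emeasurable_funM => //; apply/measurable_EFinP.
  exact: measurable_normal_pdf.
- by move=> x _; rewrite mule_ge0// lee_fin normal_pdf_ge0.
Qed.

Lemma normal_mgf (m s a : R) : s != 0 ->
  (\int[normal_prob m s]_x (expR (a * x))%:E =
   (expR (a * m + a ^+ 2 * s ^+ 2 / 2))%:E)%E.
Proof.
move=> s0.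
have N1 : (\int[normal_prob m s]_x cst 1 x = 1 :> \bar R)%E.
  rewrite integral_cst// mul1e; exact: probability_setT.
rewrite -[RHS]mule1 -[X in (_ * X)%E]N1.
rewrite -(@ge0_integral_expR_normal_prob m s a (cst 1%E))//.
by apply: eq_integral => x _; rewrite mule1.
Qed.

Lemma integrable_expR_normal_prob (m s a : R) : s != 0 ->
  (normal_prob m s).-integrable setT (fun x : R => (expR (a * x))%:E).
Proof.
move=> s0; apply/integrableP; split.
  exact: measurable_expRM.
under eq_integral do rewrite gee0_abs ?lee_fin ?expR_ge0//.
by rewrite normal_mgf// ltry.
Qed.

End normal_law.

(** * Differentiation under a normal integral *)

Section normal_characteristic.
Context {R : realType}.

Lemma is_derive_affine (c q t : R) : is_derive t 1 (fun t : R => c * t + q) c.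
Proof.
have -> : (fun t : R => c * t + q) = (c \*: id) + cst q by [].
by apply: is_derive_eq; rewrite addr0 /GRing.scale/= mulr1.
Qed.

Lemma is_derive_cos_affine (c q t : R) :
  is_derive t 1 (fun t : R => cos (c * t + q)) (- c * sin (c * t + q)).
Proof.
have := is_derive1_comp (g := fun t => c * t + q) (is_derive_cos (c * t + q))
  (is_derive_affine c q t).
by rewrite mulrC mulrN mulNr.
Qed.

Lemma is_derive_sin_affine (c q t : R) :
  is_derive t 1 (fun t : R => sin (c * t + q)) (c * cos (c * t + q)).
Proof.
have := is_derive1_comp (g := fun t => c * t + q) (is_derive_sin (c * t + q))
  (is_derive_affine c q t).
by rewrite mulrC.
Qed.

Lemma is_derive_expR_affine (c q t : R) :
  is_derive t 1 (fun t : R => expR (c * t + q)) (c * expR (c * t + q)).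
Proof.
have := is_derive1_comp (g := fun t => c * t + q) (is_derive_expR (c * t + q))
  (is_derive_affine c q t).
by rewrite mulrC.
Qed.

(** The product of y with exp (c a^2 / 2) has zero derivative. *)
Lemma linear_ode (c : R) (y : R -> R) :
  (forall a : R, is_derive a 1 y (- (c * a * y a))) ->
  forall a, y a = y 0 * expR (- (c * a ^+ 2 / 2)).
Proof.
move=> dy a.
pose z : R -> R := y * (expR \o (fun a : R => c / 2 * a ^+ 2)).
suff /(_ a 0) : forall x x', z x = z x'.
  rewrite /z !fctE /= expr0n/= mulr0 expR0 mulr1 => <-.
  have -> : c * a ^+ 2 / 2 = c / 2 * a ^+ 2 by field.
  by rewrite -[RHS]mulrA expRxMexpNx_1 mulr1.
move=> x x'; apply: is_derive_0_is_cst => {}x.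
have dq : is_derive x 1 (fun a : R => c / 2 * a ^+ 2) (c * x).
  have -> : (fun a : R => c / 2 * a ^+ 2) = (c / 2) \*: (id ^+ 2) by [].
  by apply: is_derive_eq; rewrite /GRing.scale/= expr1; field.
have de := is_derive1_comp (g := fun a => c / 2 * a ^+ 2)
  (is_derive_expR (c / 2 * x ^+ 2)) dq.
have dyx := dy x.
by apply: is_derive_eq; rewrite /GRing.scale/=; ring.
Qed.

Definition cosh_weight (x : R) := expR (2 * x) + expR (- 2 * x).

Lemma cosh_weight_ge2 x : 2 <= cosh_weight x.
Proof.
rewrite /cosh_weight mulNr expRN; set y := expR _.
have y0 : 0 < y by exact: expR_gt0.
have := sqr_ge0 (y - 1) => h.
rewrite -(ler_pM2r y0) [leRHS]mulrDl mulVf ?gt_eqF//.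
by nra.
Qed.

Lemma expR_abs_le_cosh_weight x : expR (2 * `|x|) <= cosh_weight x.
Proof.
rewrite /cosh_weight; case: (ler0P x) => _.
  by rewrite mulrN mulNr lerDr expR_ge0.
by rewrite lerDl expR_ge0.
Qed.

Lemma abs_le_cosh_weight x : `|x| <= cosh_weight x.
Proof.
apply: le_trans (expR_abs_le_cosh_weight x).
apply: le_trans (expR_ge1Dx _).
by have := normr_ge0 x; lra.
Qed.

Section derive_under.
Variable s : R.
Hypothesis s0 : s != 0.
Let N := normal_prob 0 s.

Lemma integrable_cosh_weight K :
  N.-integrable setT (EFin \o (fun x => K * cosh_weight x)).
Proof.
have -> : EFin \o (fun x => K * cosh_weight x) =
   (fun x => K%:E * ((expR (2 * x))%:E + (expR (- 2 * x))%:E))%E.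
  by apply/funext => x /=.
apply: integrableZl => //.
by apply: integrableD => //; exact: integrable_expR_normal_prob.
Qed.

Lemma integrable_le_cosh_weight K (f : R -> R) :
  measurable_fun [set: R] f -> (forall x, `|f x| <= K * cosh_weight x) ->
  N.-integrable setT (EFin \o f).
Proof.
move=> mf fK.
apply: le_integrable (integrable_cosh_weight K) => //.
  exact/measurable_EFinP.
move=> x _ /=; rewrite lee_fin (le_trans (fK x))//.
by rewrite ler_norm.
Qed.

(** One dominating function serves every differentiation below, because all the
    integrands are bounded by a constant times [cosh_weight]. *)
Lemma is_derive_normal_integral (k k' : R -> R -> R) (t0 K : R) :
  (forall t, measurable_fun [set: R] (k t)) ->
  (forall t x : R, t0 - 1 < t < t0 + 1 -> `|k t x| <= K * cosh_weight x) ->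
  (forall t x : R, is_derive t 1 (k ^~ x) (k' t x)) ->
  (forall t x : R, t0 - 1 < t < t0 + 1 -> `|k' t x| <= K * cosh_weight x) ->
  is_derive t0 1 (fun t => \int[N]_x k t x) (\int[N]_x k' t0 x).
Proof.
move=> mk kK dk k'K.
have K0 x : 0 <= K * cosh_weight x.
  apply: le_trans (normr_ge0 (k t0 x)) _; apply: kK.
  by apply/andP; split; lra.
have It0 : `]t0 - 1, t0 + 1[%classic t0 by rewrite /= in_itv/=; apply/andP; split; lra.
have intk t : `]t0 - 1, t0 + 1[%classic t -> N.-integrable setT (EFin \o k t).
  rewrite /= in_itv/= => It.
  by apply: (@integrable_le_cosh_weight K) => // x; exact: kK.
have kd t x : partial1of2 k t x = k' t x.
  by rewrite partial1of2E; exact: derive_val.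
have ub t x : `]t0 - 1, t0 + 1[%classic t -> setT x ->
    `|partial1of2 k t x| <= K * cosh_weight x.
  by rewrite /= in_itv/= => It _; rewrite kd; exact: k'K.
have der t x : `]t0 - 1, t0 + 1[%classic t -> setT x -> derivable (k ^~ x) t 1.
  by move=> _ _; exact: ex_derive.
apply: DeriveDef.
  exact: (derivable_under_integral measurableT It0 intk der K0
    (integrable_cosh_weight K) ub).
rewrite -derive1E (differentiation_under_integral measurableT It0 intk der K0
    (integrable_cosh_weight K) ub).
by apply: eq_Rintegral => x _; rewrite kd.
Qed.

End derive_under.
End normal_characteristic.

(** * Fourier transform of the normal law *)

Section normal_cos.
Context {R : realType}.
Variable s : R.
Hypothesis s0 : s != 0.
Local Notation N := (normal_prob 0 s).

Lemma measurable_cos : measurable_fun [set: R] (@cos R).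
Proof. by apply: continuous_measurable_fun => x; exact: continuous_cos. Qed.

Lemma measurable_sin : measurable_fun [set: R] (@sin R).
Proof. by apply: continuous_measurable_fun => x; exact: continuous_sin. Qed.

Lemma measurable_affine (a b : R) : measurable_fun [set: R] (fun x => a * x + b).
Proof. by apply: measurable_funD => //; exact: mulrl_measurable. Qed.

Lemma measurable_cos_affine (a b : R) :
  measurable_fun [set: R] (fun x => cos (a * x + b)).
Proof.
exact: (measurableT_comp measurable_cos (measurable_affine a b)).
Qed.

Lemma measurable_sin_affine (a b : R) :
  measurable_fun [set: R] (fun x => sin (a * x + b)).
Proof.
exact: (measurableT_comp measurable_sin (measurable_affine a b)).
Qed.

Lemma Rintegral_expR_normal_prob (h K : R) (f : R -> R) :
  measurable_fun [set: R] f -> (forall x, 0 <= f x <= K) ->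
  \int[N]_x (expR (h * x) * f x) =
  expR (h ^+ 2 * s ^+ 2 / 2) * \int[N]_x f (x + h * s ^+ 2).
Proof.
move=> mf fK.
have f0 x : 0 <= f x by case/andP: (fK x).
have mh : measurable_fun [set: R] (fun x => f (x + h * s ^+ 2)).
  by apply: (@measurableT_comp _ _ _ _ _ _ f) => //; exact: measurable_funD.
rewrite /Rintegral.
under eq_integral do rewrite EFinM.
rewrite (@ge0_integral_expR_normal_prob _ 0 s h (EFin \o f) s0); last 2 first.
- exact/measurable_EFinP.
- by move=> x; rewrite lee_fin.
rewrite mulr0 add0r fineM//.
apply: integrable_fin_num => //.
apply: (@integrable_le_cosh_weight _ _ s0 K) => // x.
case/andP: (fK (x + h * s ^+ 2)) => ? ?; rewrite ger0_norm//.
by have := cosh_weight_ge2 x; nra.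
Qed.

Lemma abs_cos_affine_le a b (x : R) : `|cos (a * x + b)| <= cosh_weight x.
Proof. by have := cosh_weight_ge2 x; have := cos_max (a * x + b); lra. Qed.

(** Stein's identity, obtained by differentiating at h = 0 both sides of the tilting
    formula [Rintegral_expR_normal_prob].  That formula is for nonnegative functions,
    hence the added constant. *)
Lemma normal_stein_one_plus_sin (a b : R) :
  \int[N]_x (x * (1 + sin (a * x + b))) =
  \int[N]_x (a * s ^+ 2 * cos (a * x + b)).
Proof.
pose f x := 1 + sin (a * x + b).
have mf : measurable_fun [set: R] f.
  by apply: measurable_funD => //; exact: measurable_sin_affine.
have fK x : 0 <= f x <= 2.
  by rewrite /f; have := sin_le1 (a * x + b); have := sin_geN1 (a * x + b); lra.
pose c := a * s ^+ 2.
have dPhi : is_derive (0 : R) 1 (fun h => \int[N]_x f (x + h * s ^+ 2))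
    (\int[N]_x (c * cos (a * x + b))).
  have -> : (fun h => \int[N]_x f (x + h * s ^+ 2)) =
     (fun h => \int[N]_x (1 + sin (c * h + (a * x + b)))).
    apply/funext => h; apply: eq_Rintegral => x _; congr (1 + sin _).
    by rewrite /c; ring.
  have -> : \int[N]_x (c * cos (a * x + b)) =
            \int[N]_x (c * cos (c * 0 + (a * x + b))).
    by apply: eq_Rintegral => x _; rewrite mulr0 add0r.
  apply: (@is_derive_normal_integral _ _ s0
    (fun h x => 1 + sin (c * h + (a * x + b)))
    (fun h x => c * cos (c * h + (a * x + b))) _ (1 + `|c|)) => [t|t x _|t x|t x _].
  - apply: measurable_funD => //.
    under eq_fun do rewrite addrCA.
    exact: measurable_sin_affine.
  - have := cosh_weight_ge2 x => G2.
    have := sin_max (c * t + (a * x + b)) => s1.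
    have := ler_normD 1 (sin (c * t + (a * x + b))); rewrite normr1 => ?.
    by have := normr_ge0 c; nra.
  - have := is_deriveD (is_derive_cst (1 : R) t 1)
      (is_derive_sin_affine c (a * x + b) t).
    by rewrite add0r.
  - have := cosh_weight_ge2 x => G2.
    have := cos_max (c * t + (a * x + b)) => s1.
    by rewrite normrM; have := normr_ge0 c; nra.
have dPsi : is_derive (0 : R) 1 (fun h => \int[N]_x (expR (h * x) * f x))
    (\int[N]_x (x * f x)).
  have -> : (fun h => \int[N]_x (expR (h * x) * f x)) =
     (fun h => \int[N]_x (expR (x * h + 0) * f x)).
    apply/funext => h; apply: eq_Rintegral => x _; congr (expR _ * _).
    by ring.
  have -> : \int[N]_x (x * f x) = \int[N]_x ((x * expR (x * 0 + 0)) * f x).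
    by apply: eq_Rintegral => x _; rewrite mulr0 add0r expR0 mulr1.
  have expw (t x : R) : 0 - 1 < t < 0 + 1 -> expR (x * t + 0) <= expR `|x|.
    rewrite addr0 sub0r add0r => t1; rewrite ler_expR (le_trans (ler_norm _))//.
    by rewrite normrM ler_piMr// ltW// ltr_norml.
  have expw2 (x : R) : expR `|x| <= cosh_weight x.
    apply: le_trans (expR_abs_le_cosh_weight x); rewrite ler_expR.
    by have := normr_ge0 x; lra.
  have expw3 (x : R) : `|x| * expR `|x| <= cosh_weight x.
    apply: le_trans (expR_abs_le_cosh_weight x).
    have -> : 2 * `|x| = `|x| + `|x| by ring.
    rewrite expRD ler_wpM2r ?expR_ge0// (le_trans _ (expR_ge1Dx _))//.
    by lra.
  apply: (@is_derive_normal_integral _ _ s0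
    (fun h x => expR (x * h + 0) * f x)
    (fun h x => x * expR (x * h + 0) * f x) _ 2) => [t|t x t1|t x|t x t1].
  - apply: measurable_funM => //; apply: (measurableT_comp (@measurable_expR R)).
    by apply: measurable_funD => //; exact: mulrr_measurable.
  - have /andP[f0 f2] := fK x.
    rewrite normrM !ger0_norm ?expR_ge0// mulrC ler_pM ?expR_ge0//.
    exact: (le_trans (expw _ _ t1) (expw2 x)).
  - have -> : (fun h : R => expR (x * h + 0) * f x) =
        f x \*: (fun h : R => expR (x * h + 0)).
      by apply/funext => h; rewrite mulrC.
    have dex := is_derive_expR_affine x 0 t.
    by apply: is_derive_eq; rewrite /GRing.scale/= mulrC.
  - have /andP[f0 f2] := fK x.
    rewrite !normrM mulrC (ger0_norm f0) ler_pM//.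
    rewrite (ger0_norm (expR_ge0 _)) (le_trans _ (expw3 x))// ler_wpM2l//.
    exact: expw.
have dgauss : is_derive (0 : R) 1 (fun h : R => expR (h ^+ 2 * s ^+ 2 / 2)) 0.
  have dq : is_derive (0 : R) 1 (fun h : R => h ^+ 2 * s ^+ 2 / 2) 0.
    have -> : (fun h : R => h ^+ 2 * s ^+ 2 / 2) = (s ^+ 2 / 2) \*: (id ^+ 2).
      apply/funext => h; transitivity (s ^+ 2 / 2 * h ^+ 2); [by field|by []].
    by apply: is_derive_eq; rewrite /GRing.scale/= expr1; ring.
  have := is_derive1_comp (g := fun h => h ^+ 2 * s ^+ 2 / 2)
    (is_derive_expR (0 ^+ 2 * s ^+ 2 / 2)) dq.
  by rewrite mulr0.
have := is_deriveM dgauss dPhi.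
have -> : (fun h : R => expR (h ^+ 2 * s ^+ 2 / 2)) *
    (fun h => \int[N]_x f (x + h * s ^+ 2)) =
  (fun h => \int[N]_x (expR (h * x) * f x)).
  by apply/funext => h; rewrite (@Rintegral_expR_normal_prob _ 2).
rewrite expr0n/= mul0r mul0r expR0 scaler0 addr0 scale1r => dPsi'.
by rewrite -(derive_val (is_derive := dPsi)) (derive_val (is_derive := dPsi')).
Qed.

Lemma normal_integrable_id : N.-integrable setT (EFin \o (fun x : R => x)).
Proof.
apply: (@integrable_le_cosh_weight _ _ s0 1) => // x.
by rewrite mul1r abs_le_cosh_weight.
Qed.

Lemma normal_integrable_cos_affine a b :
  N.-integrable setT (EFin \o (fun x : R => cos (a * x + b))).
Proof.
apply: (@integrable_le_cosh_weight _ _ s0 1) => [|x].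
  exact: measurable_cos_affine.
by rewrite mul1r abs_cos_affine_le.
Qed.

Lemma normal_integrable_Msin_affine a b :
  N.-integrable setT (EFin \o (fun x : R => x * sin (a * x + b))).
Proof.
apply: (@integrable_le_cosh_weight _ _ s0 1) => [|x].
  by apply: measurable_funM => //; exact: measurable_sin_affine.
rewrite mul1r (le_trans _ (abs_le_cosh_weight x))// normrM ler_piMr//.
exact: sin_max.
Qed.

(** The constant added to the sine is removed by the case a = b = 0 of the previous
    identity, which says that the law is centered. *)
Lemma normal_stein (a b : R) :
  \int[N]_x (x * sin (a * x + b)) = a * s ^+ 2 * \int[N]_x cos (a * x + b).
Proof.
have := normal_stein_one_plus_sin a b.
rewrite (RintegralZl _ measurableT); last exact: normal_integrable_cos_affine.
move=> <-.
transitivity (\int[N]_x x + \int[N]_x (x * sin (a * x + b))).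
  have := normal_stein_one_plus_sin 0 0.
  under eq_Rintegral do rewrite mul0r add0r sin0 addr0 mulr1.
  under [X in _ = X -> _]eq_Rintegral do rewrite !mul0r.
  by rewrite Rintegral_cst// mul0r => ->; rewrite add0r.
rewrite -RintegralD//; last 2 first.
- exact: normal_integrable_id.
- exact: normal_integrable_Msin_affine.
by apply: eq_Rintegral => x _; rewrite mulrDr mulr1.
Qed.

(** By Stein's identity the integral satisfies y' = - s^2 a y as a function of a.  Keeping
    a phase b makes the equation close up without a separate treatment of the sine. *)
Lemma normal_cos (a b : R) :
  \int[N]_x cos (a * x + b) = cos b * expR (- (s ^+ 2 * a ^+ 2 / 2)).
Proof.
suff dC (c : R) : is_derive c 1 (fun a => \int[N]_x cos (a * x + b))
    (- (s ^+ 2 * c * \int[N]_x cos (c * x + b))).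
  rewrite (linear_ode dC a); congr (_ * _).
  under eq_Rintegral do rewrite mul0r add0r.
  rewrite Rintegral_cst// -[RHS]mulr1; congr (_ * _).
  by rewrite /= (@probability_setT _ _ _ N).
move: c => {}a.
have -> : - (s ^+ 2 * a * \int[N]_x cos (a * x + b)) =
   \int[N]_x (- x * sin (x * a + b)).
  rewrite (mulrC _ a) -normal_stein -[LHS]mulN1r -RintegralZl//; last first.
    exact: normal_integrable_Msin_affine.
  by apply: eq_Rintegral => x _; rewrite mulN1r mulNr (mulrC a).
have -> : (fun a => \int[N]_x cos (a * x + b)) =
   (fun a => \int[N]_x cos (x * a + b)).
  by apply/funext => h; apply: eq_Rintegral => x _; rewrite mulrC.
apply: (@is_derive_normal_integral _ _ s0
    (fun h x => cos (x * h + b))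
    (fun h x => - x * sin (x * h + b)) _ 1) => [t|t x _|t x|t x _].
- under eq_fun do rewrite mulrC; exact: measurable_cos_affine.
- by rewrite mulrC mul1r abs_cos_affine_le.
- exact: is_derive_cos_affine.
- rewrite mul1r (le_trans _ (abs_le_cosh_weight x))// normrM normrN ler_piMr//.
  exact: sin_max.
Qed.

End normal_cos.

(** * Elementary inequalities *)

Section elementary.
Context {R : realType}.

Lemma ge0_of_derive_ge0 (f f' : R -> R) : f 0 = 0 ->
  (forall x : R, is_derive x 1 f (f' x)) -> (forall x, 0 <= x -> 0 <= f' x) ->
  forall x, 0 <= x -> 0 <= f x.
Proof.
move=> f0 df f'0 x; rewrite le_eqVlt => /predU1P[<-|x0]; first by rewrite f0.
have cf : {within `[0, x], continuous f}.
  apply: derivable_within_continuous => y _.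
  exact: (ex_derive (is_derive := df y)).
have [c + e] := MVT x0 (fun y _ => df y) cf.
rewrite in_itv/= => /andP[c0 _].
by move: e; rewrite f0 !subr0 => ->; rewrite mulr_ge0 ?f'0// ltW.
Qed.

(** Since exp x + exp (- x) - 2 is the square of exp (x / 2) - exp (- x / 2), it is
    enough to bound the hyperbolic sine from below. *)
Lemma cosh_ge (x : R) : 2 + x ^+ 2 <= expR x + expR (- x).
Proof.
have sinh_ge (y : R) : 0 <= y -> 2 * y <= expR y - expR (- y).
  move=> y0; rewrite -subr_ge0; move: y y0.
  apply: (@ge0_of_derive_ge0 (fun y => expR y - expR (- y) - 2 * y)
    (fun y => expR y + expR (- y) - 2)).
  - by rewrite oppr0 mulr0 !subrr.
  - move=> y.
    have dN := is_derive1_comp (g := -%R) (is_derive_expR (- y)) (is_deriveNid y 1).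
    have -> : (fun y : R => expR y - expR (- y) - 2 * y) =
              expR - (expR \o -%R) - 2 \*: id by [].
    by apply: is_derive_eq; rewrite /GRing.scale/=; ring.
  - move=> y _; rewrite expRN; have y0 := expR_gt0 y.
    have := sqr_ge0 (expR y - 1) => h.
    rewrite -(pmulr_lge0 _ y0) mulrBl mulrDl mulVf ?gt_eqF//.
    by nra.
wlog x0 : x / 0 <= x.
  move=> H; case: (leP 0 x) => [|/ltW x0]; first exact: H.
  by have := H (- x); rewrite oppr_ge0 sqrrN opprK addrC => /(_ x0); lra.
have := sinh_ge (x / 2); rewrite divr_ge0// => /(_ isT).
rewrite expRN.
have -> : expR x = expR (x / 2) ^+ 2 by rewrite -expRM_natl; congr expR; field.
rewrite expRN.
have -> : expR x = expR (x / 2) ^+ 2 by rewrite -expRM_natl; congr expR; field.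
have := expR_gt0 (x / 2); set y := expR _ => y0 h.
have -> : y ^+ 2 + (y ^+ 2)^-1 = (y - y^-1) ^+ 2 + 2 by field; rewrite gt_eqF.
have e : 2 * (x / 2) = x by field.
by rewrite e in h; nra.
Qed.

Lemma abs_sin_le (x : R) : `|sin x| <= `|x|.
Proof.
wlog x0 : x / 0 <= x.
  move=> H; case: (leP 0 x) => [|/ltW x0]; first exact: H.
  by have := H (- x); rewrite oppr_ge0 sinN !normrN; apply.
rewrite (ger0_norm x0) ler_norml; apply/andP; split.
  rewrite -subr_ge0 opprK; move: x x0.
  apply: (@ge0_of_derive_ge0 (fun y => sin y + y) (fun y => cos y + 1)).
  - by rewrite sin0 addr0.
  - by move=> y _; have := cos_geN1 y; lra.
rewrite -subr_ge0; move: x x0.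
apply: (@ge0_of_derive_ge0 (fun y => y - sin y) (fun y => 1 - cos y)).
- by rewrite sin0 subr0.
- by move=> y _; have := cos_le1 y; lra.
Qed.

Lemma cos_ge (x : R) : 1 - x ^+ 2 / 2 <= cos x.
Proof.
have := abs_sin_le (x / 2); rewrite -ler_sqr ?nnegrE// !real_normK ?num_real//.
have -> : cos x = cos (x / 2 + x / 2) by congr cos; field.
by rewrite cosD -!expr2 cos2sin2; nra.
Qed.

(** Comparison of the derivatives at u = 0: for small u, exp (u c) is at most
    1 / (1 - u c), which is too small when c < d. *)
Lemma le_of_expR_ge (c d : R) :
  (forall u, 0 < u -> 1 + u * d <= expR (u * c)) -> d <= c.
Proof.
move=> h; rewrite leNgt; apply/negP => cd.
pose e := d - c; have e0 : 0 < e by rewrite subr_gt0.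
pose D := 1 + `|d * c| + `|c| * e.
have D1 : 1 <= D.
  by rewrite /D -addrA lerDl addr_ge0// mulr_ge0// ltW.
have D0 : 0 < D by lra.
(* Small enough that u c < 1 and u d c < d - c. *)
pose u := e / D; have u0 : 0 < u by rewrite divr_gt0.
have uD : u * D = e by rewrite /u divfK// gt_eqF.
have uc : u * c < 1.
  rewrite -(ltr_pM2r D0) mulrAC uD mul1r.
  have := ler_norm c => ?; have := normr_ge0 (d * c) => ?.
  by rewrite /D; nra.
have := h u u0; have := expR_ge1Dx (- (u * c)); rewrite expRN => h1 h2.
have y0 := expR_gt0 (u * c).
have : (1 + u * d) * (1 - u * c) <= 1.
  rewrite -[leRHS](mulfV (lt0r_neq0 y0)).
  apply: (@le_trans _ _ (expR (u * c) * (1 - u * c))).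
    by rewrite ler_wpM2r//; lra.
  by rewrite ler_pM2l.
have : u * (d * c) < e.
  rewrite -uD ltr_pM2l// /D.
  have := ler_norm (d * c) => ?; have := normr_ge0 c => ?.
  by have := mulr_ge0 (normr_ge0 c) (ltW e0); lra.
rewrite /e => h3 h4.
have : u * (d - c - u * (d * c)) <= 0 by nra.
by rewrite pmulr_rle0// subr_le0 leNgt h3.
Qed.

End elementary.

Section gauss_integral_bound.
Context {R : realType}.

Lemma normal_peak_le (t : R) : 0 < t -> normal_peak t = t^-1 * normal_peak 1.
Proof.
move=> t0; rewrite /normal_peak expr1n mul1r -mulrnAr sqrtrM ?sqr_ge0//.
by rewrite sqrtr_sqr gtr0_norm// invfM.
Qed.

(** Dropping the factor exp (- x^2 / (2 t^2)) leaves the standard normal density,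
    up to the ratio 1 / t of the peaks. *)
Lemma normal_gauss_le (t : R) : 0 < t ->
  (\int[normal_prob 0 t]_x (expR (- (x ^+ 2 / 2)))%:E <= (t^-1)%:E)%E.
Proof.
move=> t0.
have t_neq0 : t != 0 by rewrite gt_eqF.
have mg : measurable_fun [set: R] (fun x => (expR (- (x ^+ 2 / 2)))%:E).
  apply/measurable_EFinP; apply: (measurableT_comp (@measurable_expR R)).
  apply: measurableT_comp => //; apply: measurable_funM => //.
rewrite ge0_integral_normal_prob//.
have mp s : measurable_fun [set: R] (fun x => (normal_pdf 0 s x)%:E).
  by apply/measurable_EFinP; exact: measurable_normal_pdf.
apply: (@le_trans _ _ (\int[lebesgue_measure]_x ((t^-1)%:E * (normal_pdf 0 1 x)%:E)))%E.
  apply: ge0_le_integral => //.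
  - by move=> x _; rewrite mule_ge0// lee_fin ?expR_ge0// normal_pdf_ge0.
  - exact: (emeasurable_funM mg (mp t)).
  - exact: (measurable_funeM _ (mp 1)).
  - move=> x _; rewrite -!EFinM lee_fin !normal_pdfE ?oner_neq0//.
    rewrite (normal_peak_le t0) /normal_fun subr0 expr1n mulrCA -!mulrA.
    rewrite ler_pM2l ?invr_gt0// ler_wpM2l ?normal_peak_ge0//.
    rewrite -expRD ler_expR mulr2n.
    have h : 0 <= x ^+ 2 / (t ^+ 2 *+ 2).
      by rewrite divr_ge0 ?sqr_ge0// mulrn_wge0 ?sqr_ge0.
    by move: h; rewrite mulNr; lra.
rewrite ge0_integralZl//; last 3 first.
- exact: mp.
- by move=> x _; rewrite lee_fin normal_pdf_ge0.
- by rewrite lee_fin invr_ge0 ltW.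
by rewrite integral_normal_pdf mule1.
Qed.

End gauss_integral_bound.

(** * Centered Gaussian variables *)

Section gaussian_law.
Context {R : realType} {d} {T : measurableType d} {P : probability T R}.
Implicit Types Z : {RV P >-> R}.

(** The law of Z and the reference measure nu live on two different presentations of
    the Borel sets of R, which is why the pushforward is taken again. *)
Lemma integral_law Z (nu : {measure set (measurableTypeR R) -> \bar R})
    (f : R -> \bar R) :
  (forall A : set R, measurable A -> distribution P Z A = nu A) ->
  measurable_fun [set: R] f -> (forall x, 0 <= f x)%E ->
  (\int[P]_w f (Z w) = \int[nu]_x f x)%E.
Proof.
move=> lawZ mf f0.
have mZ : measurable_fun setT (Z : T -> measurableTypeR R).
  by move=> mT A mA; exact: (measurable_funPT Z).
transitivity (\int[pushforward P (Z : T -> measurableTypeR R)]_x f x)%E.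
  by rewrite ge0_integral_pushforward.
by apply: eq_measure_integral => // A mA _; exact: lawZ.
Qed.

Lemma integrable_bounded (f : T -> R) (K : R) :
  measurable_fun setT f -> (forall w, `|f w| <= K) ->
  P.-integrable setT (EFin \o f).
Proof.
move=> mf fK.
apply: (@le_integrable _ _ _ _ _ _ _ (EFin \o cst K)) => //.
- exact/measurable_EFinP.
- by move=> w _ /=; rewrite lee_fin (le_trans (fK w))// ler_norm.
- exact: finite_measure_integrable_cst.
Qed.

Lemma Rintegral_law Z (nu : {measure set (measurableTypeR R) -> \bar R}) (f : R -> R) :
  (forall A : set R, measurable A -> distribution P Z A = nu A) ->
  measurable_fun [set: R] f -> P.-integrable setT (EFin \o (f \o Z)) ->
  \int[P]_w f (Z w) = \int[nu]_x f x.
Proof.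
move=> lawZ mf ifZ; congr fine.
have mZ : measurable_fun setT (Z : T -> measurableTypeR R).
  by move=> mT A mA; exact: (measurable_funPT Z).
have mfE : measurable_fun [set: R] (EFin \o f) by exact/measurable_EFinP.
transitivity (\int[pushforward P (Z : T -> measurableTypeR R)]_x (f x)%:E)%E.
  by rewrite integral_pushforward.
by apply: eq_measure_integral => // A mA _; exact: lawZ.
Qed.

Lemma integrable_cos (f : T -> R) : measurable_fun setT f ->
  P.-integrable setT (EFin \o (fun w => cos (f w))).
Proof.
move=> mf; apply: (@integrable_bounded _ 1) => [|w]; last exact: cos_max.
exact: (measurableT_comp measurable_cos).
Qed.

Lemma Rintegral_proba_cst (c : R) : \int[P]_w c = c.
Proof. by rewrite Rintegral_cst//= probability_setT mulr1. Qed.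

Lemma integrable_EFin_cst (c : R) : P.-integrable setT (EFin \o (fun=> c)).
Proof. exact: finite_measure_integrable_cst. Qed.

Lemma integrable_EFinD (f g : T -> R) : P.-integrable setT (EFin \o f) ->
  P.-integrable setT (EFin \o g) ->
  P.-integrable setT (EFin \o (fun w => f w + g w)).
Proof. by move=> iF iG; exact: (integrableD measurableT iF iG). Qed.

(** The parameters of the law are recovered from the first two moments without
    computing the moments of a normal law.  The inequality 1 + c Z <= exp (c Z) forces
    the mean to vanish; 2 + c^2 Z^2 <= exp (c Z) + exp (- c Z) and
    1 - c^2 Z^2 / 2 <= cos (c Z), integrated and compared near c = 0, bound the
    variance from both sides. *)
Lemma centered_gaussian_exp Z (v : R) : is_gaussian Z ->
  P.-integrable setT (EFin \o Z) -> \int[P]_w Z w = 0 ->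
  P.-integrable setT (EFin \o (fun w => Z w ^+ 2)) ->
  \int[P]_w (Z w ^+ 2) = v ->
  (forall c, \int[P]_w (expR (c * Z w))%:E = (expR (c ^+ 2 * v / 2))%:E)%E /\
  \int[P]_w cos (Z w) = expR (- (v / 2)).
Proof.
move=> [m [s [s_ge0 law]]] iZ EZ iZ2 EZ2.
have mexp c : measurable_fun [set: R] (fun x => (expR (c * x))%:E).
  exact: measurable_expRM.
have e0 c (x : R) : (0 <= (expR (c * x))%:E)%E by rewrite lee_fin expR_ge0.
case: (eqVneq s 0) law => [s0|s0] law.
  have law1 (f : R -> R) : measurable_fun [set: R] f ->
      P.-integrable setT (EFin \o (f \o Z)) -> \int[P]_w f (Z w) = f m.
    move=> mf ifZ; rewrite (@Rintegral_law Z (@dirac _ (measurableTypeR R) m R) _ law mf ifZ) /Rintegral.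
    by rewrite integral_dirac ?diracT ?mul1e//; exact/measurable_EFinP.
  have m0 : m = 0 by rewrite -EZ -(law1 id).
  have v0 : v = 0.
    by rewrite -EZ2 (law1 (fun x => x ^+ 2))// m0 expr0n.
  split=> [c|].
    rewrite (@integral_law Z (@dirac _ (measurableTypeR R) m R) _ law (mexp c) (e0 c)).
    rewrite integral_dirac//; last exact: mexp.
    by rewrite diracT mul1e m0 v0 !mulr0 mul0r.
  rewrite (law1 cos) ?m0 ?cos0 ?v0 ?mul0r ?oppr0 ?expR0//.
    exact: measurable_cos.
  exact: integrable_cos.
have hexp c : (\int[P]_w (expR (c * Z w))%:E =
    (expR (c * m + c ^+ 2 * s ^+ 2 / 2))%:E)%E.
  by rewrite (@integral_law Z (normal_prob m s) _ law (mexp c) (e0 c)) normal_mgf.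
have iexp c : P.-integrable setT (EFin \o (fun w => expR (c * Z w))).
  apply/integrableP; split.
    exact: (measurableT_comp (mexp c)).
  under eq_integral do rewrite /= ger0_norm ?expR_ge0//.
  by rewrite hexp ltry.
have rexp c : \int[P]_w expR (c * Z w) = expR (c * m + c ^+ 2 * s ^+ 2 / 2).
  by rewrite /Rintegral hexp.
have s2 : 0 < s ^+ 2 by rewrite exprn_even_gt0.
have icZ c : P.-integrable setT (EFin \o (fun w => c * Z w)).
  exact: (integrableZl _ c iZ).
have icZ2 c : P.-integrable setT (EFin \o (fun w => c * Z w ^+ 2)).
  exact: (integrableZl _ c iZ2).
have m0 : m = 0.
  have : 1 <= expR ((- m / s ^+ 2) * m + (- m / s ^+ 2) ^+ 2 * s ^+ 2 / 2).
    set c := - m / s ^+ 2; rewrite -rexp.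
    have -> : 1 = \int[P]_w (1 + c * Z w).
      rewrite RintegralD// ?RintegralZl//.
      - by rewrite EZ mulr0 addr0 Rintegral_proba_cst.
      - exact: integrable_EFin_cst.
    apply: le_Rintegral => //.
    - exact: (integrable_EFinD (integrable_EFin_cst 1) (icZ c)).
    - by move=> w _; exact: expR_ge1Dx.
  rewrite -[leLHS]expR0 ler_expR.
  have -> : - m / s ^+ 2 * m + (- m / s ^+ 2) ^+ 2 * s ^+ 2 / 2 =
            - (m ^+ 2 / (2 * s ^+ 2)) by field.
  have D0 : 0 < (2 * s ^+ 2)^-1 by rewrite invr_gt0 pmulr_rgt0.
  rewrite oppr_ge0 pmulr_lle0// => h.
  by apply/eqP; rewrite -sqrf_eq0 eq_le h sqr_ge0.
rewrite {}m0 in law hexp rexp.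
have vs : v = s ^+ 2.
  apply/eqP; rewrite eq_le; apply/andP; split.
    rewrite -(ler_pM2r (_ : 0 < 2^-1))//.
    apply: le_of_expR_ge => u u0.
    pose a := Num.sqrt u; have a2 : a ^+ 2 = u by rewrite sqr_sqrtr// ltW.
    have : \int[P]_w (2 + u * Z w ^+ 2) <=
           \int[P]_w (expR (a * Z w) + expR (- a * Z w)).
      apply: le_Rintegral => //.
      - exact: (integrable_EFinD (integrable_EFin_cst 2) (icZ2 u)).
      - exact: (integrable_EFinD (iexp a) (iexp (- a))).
      - move=> w _; have := cosh_ge (a * Z w).
        by rewrite exprMn a2 mulNr.
    rewrite (RintegralD _ (integrable_EFin_cst 2) (icZ2 u))//.
    rewrite (RintegralZl _ _ iZ2)// (RintegralD _ (iexp a) (iexp (- a)))// !rexp.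
    rewrite EZ2 Rintegral_proba_cst !mulr0 !add0r sqrrN a2 -!mulrA.
    by lra.
  rewrite -lerN2 -(ler_pM2r (_ : 0 < 2^-1))//.
  rewrite !mulNr.
  apply: le_of_expR_ge => u u0.
  pose a := Num.sqrt u; have a2 : a ^+ 2 = u by rewrite sqr_sqrtr// ltW.
  have : \int[P]_w (1 + (- (u / 2)) * Z w ^+ 2) <= \int[P]_w cos (a * Z w + 0).
    apply: le_Rintegral => //.
    - exact: (integrable_EFinD (integrable_EFin_cst 1) (icZ2 (- (u / 2)))).
    - apply: integrable_cos; apply: measurable_funD => //.
      exact: measurable_funM.
    - move=> w _; have := cos_ge (a * Z w).
      by rewrite addr0 exprMn a2; lra.
  rewrite (RintegralD _ (integrable_EFin_cst 1) (icZ2 (- (u / 2))))//.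
  rewrite (RintegralZl _ _ iZ2)//.
  rewrite EZ2 Rintegral_proba_cst.
  rewrite (@Rintegral_law Z (normal_prob 0 s) _ law (measurable_cos_affine a 0)); last first.
    apply: integrable_cos; apply: measurable_funD => //.
    exact: measurable_funM.
  rewrite normal_cos// cos0 mul1r a2.
  have -> : u * - (s ^+ 2 / 2) = - (s ^+ 2 * u / 2) by field.
  by lra.
split=> [c|]; first by rewrite hexp mulr0 add0r vs.
have -> : \int[P]_w cos (Z w) = \int[P]_w cos (1 * Z w + 0).
  by apply: eq_Rintegral => w _; rewrite mul1r addr0.
rewrite (@Rintegral_law Z (normal_prob 0 s) _ law (measurable_cos_affine 1 0)); last first.
  apply: integrable_cos; apply: measurable_funD => //.
  exact: measurable_funM.
by rewrite normal_cos// cos0 mul1r vs expr1n mulr1.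
Qed.

End gaussian_law.

(** * Linear forms of white noise *)

Section white_noise_forms.
Context {R : realType} {d} {X : measurableType d}.
Variable mu : {measure set X -> \bar R}.
Context {d'} {T : measurableType d'} {P : probability T R}.
Variable W : L2 mu -> {RV P >-> R}.
Hypothesis hW : white_noise W.

Lemma white_noise_integrableM u v :
  P.-integrable setT (EFin \o (fun w => W u w * W v w)).
Proof.
have [_ _ cov] := hW.
have sq z : P.-integrable setT (EFin \o (fun w => W z w * W z w)).
  apply/integrableP; split.
    by apply/measurable_EFinP; exact: measurable_funM.
  have := cov z z; rewrite unlock => e.
  under eq_integral do rewrite /= ger0_norm -?expr2 ?sqr_ge0// expr2.
  by rewrite e ltry.
apply: (@le_integrable _ _ _ P setT measurableT _
  (EFin \o (fun w => W u w * W u w + W v w * W v w))).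
- by apply/measurable_EFinP; exact: measurable_funM.
- move=> w _ /=; rewrite lee_fin normrM [leRHS]ger0_norm; last first.
    by rewrite -!expr2 addr_ge0 ?sqr_ge0.
  rewrite -!expr2 -(real_normK (num_real (W u w))) -(real_normK (num_real (W v w))).
  have := sqr_ge0 (`|W u w| - `|W v w|); have := normr_ge0 (W u w).
  by have := normr_ge0 (W v w); nra.
- exact: (integrable_EFinD (sq u) (sq v)).
Qed.

Lemma white_noise_integrable u : P.-integrable setT (EFin \o W u).
Proof.
apply: (@le_integrable _ _ _ P setT measurableT _
  (EFin \o (fun w => 1 + W u w * W u w))).
- by apply/measurable_EFinP.
- move=> w _ /=; rewrite lee_fin [leRHS]ger0_norm; last first.
    by rewrite -expr2 addr_ge0 ?sqr_ge0.
  rewrite -expr2 -(real_normK (num_real (W u w))).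
  by have := sqr_ge0 (`|W u w| - 1); nra.
- exact: (integrable_EFinD (integrable_EFin_cst 1) (white_noise_integrableM u u)).
Qed.

Lemma integrable_EFin_sum k (F : 'I_k -> T -> R) :
  (forall i, P.-integrable setT (EFin \o F i)) ->
  P.-integrable setT (EFin \o (fun w => \sum_(i < k) F i w)) /\
  \int[P]_w (\sum_(i < k) F i w) = \sum_(i < k) \int[P]_w F i w.
Proof.
elim: k F => [|k IH] F iF.
  have -> : (fun w => \sum_(i < 0) F i w) = (fun=> 0).
    by apply/funext => w; rewrite big_ord0.
  split; first exact: integrable_EFin_cst.
  by rewrite Rintegral_proba_cst big_ord0.
have [i1 e1] := IH (fun i => F (widen_ord (leqnSn k) i)) (fun i => iF _).
have -> : (fun w => \sum_(i < k.+1) F i w) =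
    (fun w => \sum_(i < k) F (widen_ord (leqnSn k) i) w + F ord_max w).
  by apply/funext => w; rewrite big_ord_recr.
split; first exact: integrable_EFinD.
by rewrite RintegralD// e1 big_ord_recr.
Qed.

Lemma RV_sumE k (F : 'I_k -> {RV P >-> R}) w :
  (\sum_(i < k) F i) w = \sum_(i < k) F i w.
Proof. by apply: (big_ind2 (fun (f : {RV P >-> R}) r => f w = r)) => // f _ g _ <- <-. Qed.

(** A linear form of white noise is a centered Gaussian variable whose variance is the
    squared norm of the corresponding combination of functions. *)
Lemma white_noise_exp k (a : 'I_k -> R) (u : 'I_k -> L2 mu) (f : L2 mu) :
  f = \sum_(i < k) a i *: u i ->
  (forall c, \int[P]_w (expR (c * \sum_(i < k) a i * W (u i) w))%:E =
    (expR (c ^+ 2 * inner f f / 2))%:E)%E /\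
  \int[P]_w cos (\sum_(i < k) a i * W (u i) w) = expR (- (inner f f / 2)).
Proof.
move=> fE; have [gW EW cov] := hW.
pose Z : {RV P >-> R} := \sum_(i < k) a i *: W (u i).
have ZE w : Z w = \sum_(i < k) a i * W (u i) w by rewrite RV_sumE.
have ZE' : (Z : T -> R) = (fun w => \sum_(i < k) a i * W (u i) w).
  by apply/funext => w; exact: ZE.
have iaW i : P.-integrable setT (EFin \o (fun w => a i * W (u i) w)).
  exact: (integrableZl measurableT (a i) (white_noise_integrable (u i))).
have [iZ EZ] := integrable_EFin_sum iaW.
have Z2E w : Z w ^+ 2 =
    \sum_(i < k) \sum_(j < k) a i * a j * (W (u i) w * W (u j) w).
  rewrite ZE expr2 mulr_suml; apply: eq_bigr => i _.
  rewrite mulr_sumr; apply: eq_bigr => j _; ring.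
have iaWW i j :
    P.-integrable setT (EFin \o (fun w => a i * a j * (W (u i) w * W (u j) w))).
  exact: (integrableZl measurableT (a i * a j) (white_noise_integrableM _ _)).
have iaWWs i := integrable_EFin_sum (iaWW i).
have [iZ2 EZ2] := integrable_EFin_sum (fun i => (iaWWs i).1).
have := @centered_gaussian_exp _ _ _ _ Z (inner f f) (gW _ _ _).
rewrite ZE'.
case.
- exact: iZ.
- rewrite EZ big1// => i _; rewrite RintegralZl//; last first.
    exact: white_noise_integrable.
  have := EW (u i); rewrite unlock /Rintegral => ->.
  by rewrite mulr0.
- rewrite (_ : (fun w => _ ^+ 2) = (fun w =>
    \sum_(i < k) \sum_(j < k) a i * a j * (W (u i) w * W (u j) w)))//.
  by apply/funext => w; rewrite -ZE Z2E.
- under eq_Rintegral do rewrite -ZE Z2E.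
  rewrite EZ2 fE inner_suml; apply: eq_bigr => i _.
  rewrite (iaWWs i).2 inner_sumr; apply: eq_bigr => j _.
  rewrite RintegralZl//; last exact: white_noise_integrableM.
  have := cov (u i) (u j); rewrite unlock /Rintegral => -> /=.
  by rewrite innerZl innerZr mulrA.
- by move=> h1 h2; split=> // c; rewrite -h1.
Qed.

End white_noise_forms.

(** * Small balls of Gaussian vectors *)

Section small_ball.
Context {R : realType} {d} {T : measurableType d} {P : probability T R}.

Lemma markov_ge0 (f : T -> R) (c : R) (B : \bar R) : 0 < c ->
  measurable_fun setT f -> (forall w, 0 <= f w) ->
  (\int[P]_w (f w)%:E <= B)%E ->
  (c%:E * P [set w | (c <= f w)%R] <= B)%E.
Proof.
move=> c0 mf f0; apply: le_trans.
have mA : measurable [set w | c <= f w].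
  rewrite -[X in measurable X]setTI.
  exact: (measurable_fun_le measurableT (measurable_cst c) mf).
have -> : (c%:E * P [set w | (c <= f w)%R] =
    \int[P]_w (c * \1_[set w | (c <= f w)%R] w)%R%:E)%E.
  under eq_integral do rewrite EFinM.
  rewrite ge0_integralZl//; last 2 first.
  - exact/measurable_EFinP/measurable_indic.
  - by rewrite lee_fin ltW.
  by rewrite integral_indic// setIT.
apply: ge0_le_integral => //.
- by move=> w _; rewrite lee_fin mulr_ge0// ltW.
- by apply/measurable_EFinP; apply: measurable_funM => //; exact: measurable_indic.
- exact/measurable_EFinP.
- move=> w _; rewrite lee_fin indicE.
  by case: (boolP (w \in _)) => [/set_mem/= cw|_]; rewrite ?mulr1 ?mulr0.
Qed.

Variable X : nat -> T -> R.
Hypothesis mX : forall i, measurable_fun setT (X i).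
Variable n : nat.
Hypothesis hcos : forall a : nat -> R,
  \int[P]_w cos (\sum_(0 <= i < n) a i * X i w) =
  expR (- (\sum_(0 <= i < n) a i ^+ 2) / 2).

Variable t : R.
Hypothesis t0 : 0 < t.
Let N := normal_prob 0 t.
Let C := \int[N]_x expR (- (x ^+ 2 / 2)).

(** Induction on k.  By [normal_cos], the factor exp (- t^2 X_k^2 / 2) together with the
    cosine is the average over a normal x of the cosine in which X_k has coefficient x;
    after Fubini's theorem the induction hypothesis applies with this coefficient.
    Only the laws of linear forms of the X_i enter. *)
Lemma laplace_cos k (a : nat -> R) : (k <= n)%N ->
  \int[P]_w (expR (- (t ^+ 2 / 2 * \sum_(0 <= i < k) X i w ^+ 2)) *
             cos (\sum_(k <= i < n) a i * X i w)) =
  C ^+ k * expR (- (\sum_(k <= i < n) a i ^+ 2) / 2).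
Proof.
have t_neq0 : t != 0 by rewrite gt_eqF.
elim: k a => [|k IH] a kn.
  rewrite expr0 mul1r -hcos; apply: eq_Rintegral => w _.
  by rewrite big_geq// mulr0 oppr0 expR0 mul1r.
pose S w := expR (- (t ^+ 2 / 2 * \sum_(0 <= i < k) X i w ^+ 2)).
pose V w := \sum_(k.+1 <= i < n) a i * X i w.
pose F (z : T * measurableTypeR R) := S z.1 * cos (X k z.1 * z.2 + V z.1).
have mS : measurable_fun setT S.
  apply: (measurableT_comp (@measurable_expR R)); apply: measurableT_comp => //.
  apply: measurable_funM => //; apply: measurable_sum => i.
  exact: measurable_funX.
have mV : measurable_fun setT V.
  by apply: measurable_sum => i; exact: measurable_funM.
have mF : measurable_fun setT F.
  apply: measurable_funM; first exact: (measurableT_comp mS).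
  apply: (measurableT_comp measurable_cos); apply: measurable_funD.
    apply: measurable_funM; last exact: measurable_snd.
    exact: (measurableT_comp (mX k)).
  exact: (measurableT_comp mV).
have S1 w : 0 <= S w <= 1.
  rewrite expR_ge0/= -[leRHS]expR0 ler_expR oppr_le0 mulr_ge0//.
    by rewrite divr_ge0// sqr_ge0.
  by apply: sumr_ge0 => i _; exact: sqr_ge0.
have F1 z : `|F z| <= 1.
  have /andP[s0 s1] := S1 z.1.
  by rewrite normrM (ger0_norm s0) mulr_ile1// cos_max.
have mFx (w : T) : measurable_fun [set: R] (fun x => F (w, x)).
  exact: (measurable_funM (measurable_cst (S w)) (measurable_cos_affine (X k w) (V w))).
have iFx w : N.-integrable setT (EFin \o (fun x => F (w, x))).
  apply: (@integrable_bounded _ _ _ N _ 1); first exact: mFx.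
  by move=> x; exact: F1.
have iFw (x : R) : P.-integrable setT (EFin \o (fun w => F (w, x))).
  apply: (@integrable_bounded _ _ _ P _ 1) => [|w]; last exact: F1.
  apply: measurable_funM => //; apply: (measurableT_comp measurable_cos).
  by apply: measurable_funD => //; exact: measurable_funM.
have iF : (P \x N)%E.-integrable setT (EFin \o F).
  apply/integrable12ltyP; first exact/measurable_EFinP.
  apply: (@le_lt_trans _ _ (\int[P]_w 1)%E); last first.
    by rewrite integral_cst//= probability_setT mule1 ltry.
  apply: ge0_le_integral => //.
  - by move=> w _; exact: integral_ge0.
  - apply: (@measurable_fun_fubini_tonelli_F _ _ _ _ _ N
      (fun z => `|(F z)%:E|%E)) => //.
    by apply: measurableT_comp => //; exact/measurable_EFinP.
  - move=> w _; apply: (@le_trans _ _ (\int[N]_x 1)%E); last first.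
      by rewrite integral_cst// mul1e; exact: probability_le1.
    apply: ge0_le_integral => //.
      apply: measurableT_comp => //; exact: (measurable_int _ (iFx w)).
    move=> x _; rewrite /= lee_fin; exact: F1.
have EFin_Rint d1 (T1 : measurableType d1) (Q : probability T1 R) (f : T1 -> R) :
    Q.-integrable setT (EFin \o f) ->
    (\int[Q]_w (f w)%:E)%E = (\int[Q]_w f w)%:E.
  by move=> iq; rewrite /Rintegral fineK//; exact: integrable_fin_num.
(* Integrating x first gives the left-hand side, integrating the outcome first gives
   the induction hypothesis. *)
have := congr1 fine (Fubini iF).
under eq_integral => w _.
  rewrite (EFin_Rint _ _ N _ (iFx w)) /F /=.
  rewrite RintegralZl//; last first.
    exact: (normal_integrable_cos_affine t_neq0 (X k w) (V w)).
  rewrite (normal_cos t_neq0).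
  over.
under [X in _ = fine X -> _]eq_integral => x _.
  rewrite (EFin_Rint _ _ P _ (iFw x)) /F /=.
  over.
move=> H.
transitivity (\int[P]_w (S w * (cos (V w) * expR (- (t ^+ 2 * X k w ^+ 2 / 2))))).
  apply: eq_Rintegral => w _.
  rewrite big_nat_recr//=; set s := \sum_(0 <= i < k) _.
  have -> : - (t ^+ 2 / 2 * (s + X k w ^+ 2)) =
    - (t ^+ 2 / 2 * s) + - (t ^+ 2 * X k w ^+ 2 / 2) by field.
  by rewrite expRD -mulrA (mulrC (expR _) (cos _)).
rewrite {1}/Rintegral H.
transitivity (\int[N]_x (C ^+ k * expR (- (\sum_(k.+1 <= i < n) a i ^+ 2) / 2) *
    expR (- (x ^+ 2 / 2)))).
  apply: eq_Rintegral => x _.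
  pose a' i := if i == k then x else a i.
  have a'E i : (k < i)%N -> a' i = a i by rewrite /a'; case: ltngtP.
  have a'k : a' k = x by rewrite /a' eqxx.
  transitivity (\int[P]_w (S w * cos (\sum_(k <= i < n) a' i * X i w))).
    apply: eq_Rintegral => w _; congr (_ * cos _).
    rewrite (big_ltn kn) a'k mulrC; congr (_ + _).
    rewrite /V; apply: eq_big_nat => i /andP[ki _].
    by rewrite a'E.
  rewrite (IH a' (ltnW kn)) -mulrA; congr (_ * _).
  rewrite (big_ltn kn) a'k -expRD; congr expR.
  have -> : \sum_(k.+1 <= i < n) a' i ^+ 2 = \sum_(k.+1 <= i < n) a i ^+ 2.
    apply: eq_big_nat => i /andP[ki _].
    by rewrite a'E.
  by field.
rewrite RintegralZl//; last first.
  apply: (@integrable_bounded _ _ _ N _ 1).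
    apply: (measurableT_comp (@measurable_expR R)); apply: measurableT_comp => //.
    by apply: measurable_funM => //; exact: exprn_measurable.
  move=> x; rewrite ger0_norm ?expR_ge0// -[leRHS]expR0 ler_expR oppr_le0.
  by rewrite divr_ge0// sqr_ge0.
by rewrite exprSr mulrAC.
Qed.

(** The case k = n, where the cosine disappears. *)
Lemma laplace_sum_sqr :
  (\int[P]_w (expR (- (t ^+ 2 / 2 * \sum_(0 <= i < n) X i w ^+ 2)))%:E
   <= (t^-1 ^+ n)%:E)%E.
Proof.
have mS : measurable_fun setT
    (fun w => expR (- (t ^+ 2 / 2 * \sum_(0 <= i < n) X i w ^+ 2))).
  apply: (measurableT_comp (@measurable_expR R)); apply: measurableT_comp => //.
  apply: measurable_funM => //; apply: measurable_sum => i.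
  exact: measurable_funX.
have := laplace_cos (fun=> 0) (leqnn n).
under eq_Rintegral do rewrite (big_geq (leqnn n)) cos0 mulr1.
rewrite (big_geq (leqnn n)) oppr0 mul0r expR0 mulr1 => e.
have C0 : 0 <= C by apply: Rintegral_ge0 => x _; exact: expR_ge0.
have Ct : C <= t^-1.
  rewrite -lee_fin /C /Rintegral fineK; first exact: normal_gauss_le.
  rewrite ge0_fin_numE.
    exact: le_lt_trans (normal_gauss_le t0) (ltry _).
  by apply: integral_ge0 => x _; rewrite lee_fin expR_ge0.
have iS : P.-integrable setT
    (EFin \o (fun w => expR (- (t ^+ 2 / 2 * \sum_(0 <= i < n) X i w ^+ 2)))).
  apply: (@integrable_bounded _ _ _ P _ 1) => // w.
  rewrite ger0_norm ?expR_ge0// -[leRHS]expR0 ler_expR oppr_le0 mulr_ge0//.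
    by rewrite divr_ge0// sqr_ge0.
  by apply: sumr_ge0 => i _; exact: sqr_ge0.
have := integrable_fin_num measurableT iS => /fineK <-.
by rewrite lee_fin; move: e; rewrite /Rintegral => ->; rewrite lerXn2r// nnegrE invr_ge0 ltW.
Qed.

End small_ball.

(** Markov's inequality for the Laplace transform at t^2 / 2, with t = exp (kappa + 1):
    the bound is exp n / t^n. *)
Lemma gaussian_small_ball {R : realType} {d} {T : measurableType d}
    {P : probability T R} (X : nat -> T -> R) (kappa : R) (n : nat) :
  (forall i, measurable_fun setT (X i)) ->
  (forall a : nat -> R,
    \int[P]_w cos (\sum_(0 <= i < n) a i * X i w) =
    expR (- (\sum_(0 <= i < n) a i ^+ 2) / 2)) ->
  (P [set w | (expR (kappa + 1) ^+ 2 / 2 * \sum_(0 <= i < n) X i w ^+ 2 <= n%:R)%R]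
   <= (expR (- (kappa * n%:R)))%:E)%E.
Proof.
move=> mX hcos; set t := expR (kappa + 1).
have t0 : 0 < t by exact: expR_gt0.
pose f w := expR (- (t ^+ 2 / 2 * \sum_(0 <= i < n) X i w ^+ 2)).
have mf : measurable_fun setT f.
  apply: (measurableT_comp (@measurable_expR R)); apply: measurableT_comp => //.
  apply: measurable_funM => //; apply: measurable_sum => i.
  exact: measurable_funX.
have := @markov_ge0 _ _ _ _ f (expR (- n%:R)) _ (expR_gt0 _) mf
  (fun w => expR_ge0 _) (laplace_sum_sqr mX hcos t0).
under eq_set do rewrite ler_expR lerN2.
rewrite muleC -lee_pdivlMr ?expR_gt0//; congr (_ <= _)%E.
rewrite /t -!expRN opprK -expRM_natl -EFinM -expRD; congr (expR _)%:E.
by ring.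
Qed.

(** * Bias and noise on a model *)

Section model_geometry.
Context {R : realType} {d} {X : measurableType d}.
Variable mu : {measure set X -> \bar R}.
Variables (k : nat) (e : 'I_k -> L2 mu) (m : set (L2 mu)).
Hypothesis he : orthonormal_basis e m.

Definition basis_proj (s : L2 mu) : L2 mu := \sum_(i < k) inner (e i) s *: e i.

Definition bias2 (s : L2 mu) : R := inner (basis_proj s - s) (basis_proj s - s).

Lemma inner_orthonormal_sum (a : 'I_k -> R) j :
  inner (\sum_(i < k) a i *: e i) (e j) = a j.
Proof.
rewrite inner_suml (bigD1 j)//= innerZl he.1 eqxx mulr1 big1 ?addr0// => i ij.
by rewrite innerZl he.1 (negbTE ij) mulr0.
Qed.

Lemma inner_orthonormal_sums (a b : 'I_k -> R) :
  inner (\sum_(i < k) a i *: e i) (\sum_(i < k) b i *: e i) =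
  \sum_(i < k) a i * b i.
Proof.
rewrite inner_sumr; apply: eq_bigr => j _.
by rewrite innerZr inner_orthonormal_sum mulrC.
Qed.

Lemma basis_proj_mem s : m (basis_proj s).
Proof.
rewrite -he.2; exists k, (fun i => inner (e i) s), e; split; last exact: aeW.
by move=> i; exists i.
Qed.

(** Orthogonality is checked on the basis, then extended to almost everywhere
    combinations of its elements. *)
Lemma basis_proj_orthogonal s u : m u -> inner (s - basis_proj s) u = 0.
Proof.
have orth j : inner (s - basis_proj s) (e j) = 0.
  by rewrite innerBl inner_orthonormal_sum innerC subrr.
rewrite -{1}he.2 => -[l [a [h [hh /inner_ae_eqr ->]]]].
rewrite inner_sumr big1// => i _; rewrite innerZr.
by have [j _ <-] := hh i; rewrite orth mulr0.
Qed.

(** All representatives of the projection are at the same distance from s, so the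
    arbitrary choice in [orth_proj] does not matter. *)
Lemma orth_proj_bias s : L2norm (orth_proj m s - s) ^+ 2 = bias2 s.
Proof.
rewrite L2norm_sq /orth_proj; case: xgetP => [q qE [mq oq]|nq]; last first.
  exfalso; apply: (nq (basis_proj s)); split; first exact: basis_proj_mem.
  by move=> u; exact: basis_proj_orthogonal.
have mp := basis_proj_mem s.
have op u : m u -> inner (s - basis_proj s) u = 0 by exact: basis_proj_orthogonal.
have := oq _ mp; have := oq _ mq; have := op _ mp; have := op _ mq.
rewrite /bias2 !(innerBl, innerBr) (innerC q s) (innerC (basis_proj s) s).
by rewrite (innerC (basis_proj s) q); lra.
Qed.

Lemma bias2E s : bias2 s = inner s s - \sum_(i < k) inner (e i) s ^+ 2.
Proof.
rewrite /bias2 !(innerBl, innerBr) (innerC s) inner_orthonormal_sums.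
have -> : inner (basis_proj s) s = \sum_(i < k) inner (e i) s ^+ 2.
  by rewrite inner_suml; apply: eq_bigr => i _; rewrite innerZl.
by under eq_bigr do rewrite -expr2; ring.
Qed.

Lemma bias2_ge0 s : 0 <= bias2 s. Proof. exact: inner_ge0. Qed.

(** The estimator interpolates the linear version of the data on the basis. *)
Lemma contrast_estimator (y : L2 mu -> R) :
  contrast (linear_version y e) (estimator y e) = - \sum_(i < k) y (e i) ^+ 2.
Proof.
rewrite /contrast /linear_version L2norm_sq inner_orthonormal_sums.
have -> : \sum_(i < k) inner (estimator y e) (e i) * y (e i) =
          \sum_(i < k) y (e i) * y (e i).
  by apply: eq_bigr => i _; rewrite inner_orthonormal_sum.
by under [in RHS]eq_bigr do rewrite expr2; ring.
Qed.

Context {d'} {T : measurableType d'} {P : probability T R}.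
Variable W : L2 mu -> {RV P >-> R}.

Definition noise2 (w : T) : R := \sum_(i < k) W (e i) w ^+ 2.

(** The noise integrated against s_m - s, the random part of the criterion that does
    not come from the quadratic noise on the model. *)
Definition bias_noise (s : L2 mu) (w : T) : R :=
  \sum_(i < k) inner (e i) s * W (e i) w - W s w.

Lemma noise2_ge0 w : 0 <= noise2 w.
Proof. by apply: sumr_ge0 => i _; exact: sqr_ge0. Qed.

(** Pythagoras: the noise part of the estimator lies in the model, and the bias is
    orthogonal to it. *)
Lemma estimator_loss s n w : (0 < n)%N ->
  L2norm (estimator (observation W s n w) e - s) ^+ 2 =
  bias2 s + noise2 w / n%:R.
Proof.
move=> n0; rewrite L2norm_sq.
pose r := (Num.sqrt (n%:R : R))^-1.
have r2 : r ^+ 2 = n%:R^-1 by rewrite exprVn sqr_sqrtr.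
pose v : L2 mu := \sum_(i < k) W (e i) w *: e i.
have -> : estimator (observation W s n w) e = basis_proj s + r *: v.
  rewrite /estimator /observation /basis_proj scaler_sumr -big_split/=.
  by apply: eq_bigr => i _; rewrite scalerA -scalerDl.
have mv : m v.
  rewrite -he.2; exists k, (fun i => W (e i) w), e; split; last exact: aeW.
  by move=> i; exists i.
have vv : inner v v = noise2 w.
  by rewrite inner_orthonormal_sums; apply: eq_bigr => i _; rewrite expr2.
rewrite addrAC /bias2; set p := basis_proj s - s.
have pv : inner p v = 0.
  by rewrite /p -opprB innerNl basis_proj_orthogonal// oppr0.
clearbody p; rewrite innerDl !innerDr !innerZl !innerZr.
by rewrite (innerC v p) pv vv -r2; ring.
Qed.

(** The terms [inner s s] and [W s w] are the same for all models and cancel when two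
    models are compared. *)
Lemma criterion_value s n w : (0 < n)%N ->
  contrast (linear_version (observation W s n w) e)
    (estimator (observation W s n w) e) =
  bias2 s - inner s s - 2 / Num.sqrt n%:R * (bias_noise s w + W s w)
    - noise2 w / n%:R.
Proof.
move=> n0; rewrite contrast_estimator bias2E /bias_noise /noise2 subrK.
set r := (Num.sqrt (n%:R : R))^-1.
have r2 : n%:R^-1 = r ^+ 2 by rewrite exprVn sqr_sqrtr.
have -> : \sum_(i < k) observation W s n w (e i) ^+ 2 =
  \sum_(i < k) inner (e i) s ^+ 2 +
  2 * r * (\sum_(i < k) inner (e i) s * W (e i) w) +
  r ^+ 2 * \sum_(i < k) W (e i) w ^+ 2.
  rewrite !mulr_sumr -!big_split/=; apply: eq_bigr => i _.
  by rewrite /observation -/r; ring.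
by rewrite r2; ring.
Qed.

Hypothesis hW : white_noise W.

Lemma bias_noise_mgf s (c : R) :
  (\int[P]_w (expR (c * bias_noise s w))%:E = (expR (c ^+ 2 * bias2 s / 2))%:E)%E.
Proof.
pose a (i : 'I_k.+1) := if unlift ord_max i is Some j then inner (e j) s else -1.
pose u (i : 'I_k.+1) := if unlift ord_max i is Some j then e j else s.
have widenE (i : 'I_k) : widen_ord (leqnSn k) i = lift ord_max i.
  by apply: val_inj; rewrite /= /bump leqNgt ltn_ord.
have [|+ _] := @white_noise_exp _ _ _ _ _ _ _ W hW _ a u (basis_proj s - s).
  rewrite big_ord_recr/= {2}/a {2}/u unlift_none scaleN1r; congr (_ - _).
  by apply: eq_bigr => i _; rewrite widenE /a /u liftK.
have E w : bias_noise s w = \sum_(i < k.+1) a i * W (u i) w.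
  rewrite big_ord_recr/= {2}/a {2}/u unlift_none mulN1r; congr (_ - _).
  by apply: eq_bigr => i _; rewrite widenE /a /u liftK.
move=> /(_ c) h; rewrite /bias2 -h; apply: eq_integral => w _.
by rewrite E.
Qed.

Lemma measurable_bias_noise s : measurable_fun setT (bias_noise s).
Proof.
apply: measurable_funB => //; apply: measurable_sum => i.
exact: measurable_funM.
Qed.

Lemma measurable_noise2 : measurable_fun setT noise2.
Proof. by apply: measurable_sum => i; exact: measurable_funX. Qed.

(** Fixing c and letting the threshold depend on the bias avoids dividing by the
    standard deviation, which may be zero. *)
Lemma bias_noise_tail s (c x : R) :
  (P [set w | (x <= c * bias_noise s w - c ^+ 2 * bias2 s / 2)%R]
    <= (expR (- x))%:E)%E.
Proof.
have mf : measurable_fun setT (fun w => expR (c * bias_noise s w)).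
  apply: (measurableT_comp (@measurable_expR R)); apply: measurable_funM => //.
  exact: measurable_bias_noise.
have hle : (\int[P]_w (expR (c * bias_noise s w))%:E <=
    (expR (c ^+ 2 * bias2 s / 2))%:E)%E by rewrite bias_noise_mgf.
have := markov_ge0 (expR_gt0 (x + c ^+ 2 * bias2 s / 2)) mf
  (fun w => expR_ge0 _) hle.
under eq_set do rewrite ler_expR -lerBrDr.
rewrite muleC -lee_pdivlMr ?expR_gt0// -expRN -EFinM -expRD.
by congr (_ <= (expR _)%:E)%E; ring.
Qed.

(** The coordinates of the noise are extended by zero to a sequence. *)
Lemma noise2_small_ball (kappa : R) :
  (P [set w | (expR (kappa + 1) ^+ 2 / 2 * noise2 w <= k%:R)%R]
   <= (expR (- (kappa * k%:R)))%:E)%E.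
Proof.
pose Y (i : nat) : T -> R := oapp (fun j => W (e j) : T -> R) (cst 0) (insub i).
have YE (j : 'I_k) : Y j = W (e j) by rewrite /Y insubT//= => ?; congr (W (e _)); exact: val_inj.
have := @gaussian_small_ball _ _ _ P Y kappa k.
have noiseE w : \sum_(0 <= i < k) Y i w ^+ 2 = noise2 w.
  by rewrite big_mkord; apply: eq_bigr => i _; rewrite YE.
under eq_set do rewrite noiseE.
apply.
- by move=> i; rewrite /Y; case: (insub i) => [j|]//=.
- move=> a.
  have [_] := @white_noise_exp _ _ _ _ _ _ _ W hW _ (fun i : 'I_k => a i) e _ erefl.
  rewrite inner_orthonormal_sums big_mkord mulNr.
  under [in X in _ = X -> _]eq_bigr do rewrite -expr2.
  move=> <-; apply: eq_Rintegral => w _; congr cos.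
  by rewrite big_mkord; apply: eq_bigr => i _; rewrite YE.
Qed.

End model_geometry.

(** * Countable families of events *)

Section countable_families.
Context {I : choiceType}.

(** For each n only finitely many terms exceed 1 / (n + 1). *)
Lemma esum_bounded_countable {R : realType} (A : set I) (a : I -> R) (C : R) :
  (forall i, A i -> 0 < a i) -> (\esum_(i in A) (a i)%:E <= C%:E)%E ->
  countable A.
Proof.
move=> a0 aC.
have -> : A = \bigcup_n [set i | A i /\ n.+1%:R^-1 < a i].
  apply/seteqP; split => [i Ai|i [n _ []]//].
  have /ltr_add_invr[k] := a0 _ Ai; rewrite add0r => ki.
  by exists k.
apply: bigcup_countable => // n _; apply: finite_set_countable.
apply: contrapT => inf.
pose N := (Num.truncn (C * n.+1%:R)).+1.
have CN : C * n.+1%:R < N%:R by rewrite /N truncnS_gt.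
have [B BA NB] := infinite_set_fset N inf.
suff : ((N%:R / n.+1%:R)%:E <= C%:E)%E.
  by rewrite lee_fin ler_pdivrMr// leNgt CN.
apply: le_trans aC; apply: esum_ge; exists [set` B].
  by split; [exact: finite_fset|move=> i /BA[]].
rewrite fsbig_finite//= set_fsetK sumEFin lee_fin.
apply: (@le_trans _ _ (\sum_(i <- B) n.+1%:R^-1)).
  rewrite big_const_seq count_predT iter_addr_0 -[leRHS]mulr_natl.
  by rewrite ler_pM2r ?ler_nat ?invr_gt0.
rewrite big_seq [leRHS]big_seq; apply: ler_sum => i /BA[_ /ltW]//.
Qed.

Context {d} {T : measurableType d}.

(** An injection f of A into the natural numbers regroups the union into a sequence
    whose term of index f i is E i. *)
Lemma countable_bigcup_measurable (A : set I) (E : I -> set T) :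
  countable A -> (forall i, A i -> measurable (E i)) ->
  measurable (\bigcup_(i in A) E i).
Proof.
move=> /countable_injP[f injf] mE.
have -> : \bigcup_(i in A) E i =
    \bigcup_(k in f @` A) \bigcup_(i in A `&` f @^-1` [set k]) E i.
  apply/seteqP; split=> [w [i Ai Ew]|w [k _ [i [Ai _] Ew]]]; last by exists i.
  by exists (f i); [exists i|exists i].
apply: bigcup_measurable => k [j Aj <-].
suff -> : \bigcup_(i in A `&` f @^-1` [set f j]) E i = E j by exact: mE.
apply/seteqP; split=> [w [i [Ai /= fij] Ew]|w Ew]; last by exists j.
by have <- : i = j := injf _ _ (mem_set Ai) (mem_set Aj) fij.
Qed.

Lemma countable_union_bound {R : realType} (P : {measure set T -> \bar R})
    (A : set I) (E : I -> set T) (a : I -> \bar R) :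
  countable A -> (forall i, A i -> measurable (E i)) ->
  (forall i, A i -> P (E i) <= a i)%E ->
  (P (\bigcup_(i in A) E i) <= \esum_(i in A) a i)%E.
Proof.
move=> cA mE Ea; have mU := countable_bigcup_measurable cA mE.
have [f injf] := elimT (countable_injP A) cA.
pose F k := \bigcup_(i in A `&` f @^-1` [set k]) E i.
have FE j : A j -> F (f j) = E j.
  move=> Aj; apply/seteqP; split=> [w [i [Ai /= fij] Ew]|w Ew]; last by exists j.
  by have <- : i = j := injf _ _ (mem_set Ai) (mem_set Aj) fij.
have F0 k : ~ (f @` A) k -> F k = set0.
  move=> nk; rewrite /F bigcup0// => i [Ai /= fi]; exfalso; apply: nk.
  by exists i.
have mF k : measurable (F k).
  have [[j Aj <-]|nk] := pselect ((f @` A) k); first by rewrite FE//; exact: mE.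
  by rewrite F0.
apply: (@le_trans _ _ (\sum_(k <oo) P (F k))%E).
  apply: measure_sigma_subadditive => // w [i Ai Ew].
  by exists (f i) => //; exists i.
rewrite (_ : (\sum_(k <oo) P (F k))%E = (\esum_(k in f @` A) P (F k))%E); last first.
  rewrite nneseries_esumT// (esum_mkcond (f @` A)).
  apply: eq_esum => k _; case: ifPn => //; rewrite notin_setE => /F0 ->.
  by rewrite measure0.
rewrite (reindex_esum A (f @` A) f); last first.
  split=> [i Ai|i j /set_mem Ai /set_mem Aj|k [i Ai <-]];
    [by exists i|exact: injf (mem_set Ai) (mem_set Aj)|by exists i].
by apply: le_esum => i Ai; rewrite FE//; exact: Ea.
Qed.

End countable_families.

(** * Outcomes on which all noise terms are controlled *)

Section selected_model.
Context {R : realType} {d} {X : measurableType d}.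
Variable mu : {measure set X -> \bar R}.
Context {d'} {T : measurableType d'} {P : probability T R}.
Variable W : L2 mu -> {RV P >-> R}.
Hypothesis hW : white_noise W.
Variable M : nat -> set (set (L2 mu)).
Variable e : forall m : set (L2 mu), 'I_(model_dim m) -> L2 mu.
Hypothesis he : forall n m, (0 < n)%N -> M n m -> orthonormal_basis (@e m) m.
Variable lambda : nat -> R.
Variable mhat : nat -> (L2 mu -> R) -> set (L2 mu).
Hypothesis hmhat : selection_rule W M lambda e mhat.

Definition loss n s w :=
  L2norm (selected_estimator e mhat n (observation W s n w) - s) ^+ 2.

Lemma measurable_loss n s : (0 < n)%N -> countable (M n) ->
  measurable_fun setT (loss n s).
Proof.
move=> n0 cM _ Y mY; rewrite setTI.
have [Mhat mhat_meas _] := hmhat n0.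
pose f m w := bias2 (@e m) s + noise2 (@e m) W w / n%:R.
have -> : loss n s @^-1` Y = \bigcup_(m in M n)
    ([set w | mhat n (observation W s n w) = m] `&` f m @^-1` Y).
  have rf m w : M n m -> mhat n (observation W s n w) = m -> loss n s w = f m w.
    move=> Mm E; rewrite /loss /selected_estimator E.
    by apply: (estimator_loss (he n0 Mm)).
  apply/seteqP; split=> [w Yw|w [m Mm [/= E Yw]]].
    exists (mhat n (observation W s n w)) => //; split => //=.
    by rewrite -(rf _ w).
  by rewrite /= (rf m).
apply: countable_bigcup_measurable => // m Mm.
apply: measurableI; first exact: mhat_meas.
rewrite -[X in measurable X]setTI.
have mf : measurable_fun setT (f m).
  apply: measurable_funD => //; apply: measurable_funM => //.
  exact: measurable_noise2.
exact: mf.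
Qed.

(** The bad events have total probability at most q + (1 - q) / 4 + (1 - q) / 4 < 1: the
    union bound over the collection, one further event Bad', and the event that the
    loss exceeds 4 / (1 - q) times the bound B on its mean. *)
Lemma good_outcome n s (q B : R) (x : set (L2 mu) -> R)
    (Bad : set (L2 mu) -> set T) (Bad' : set T) :
  (0 < n)%N -> countable (M n) -> q < 1 -> 0 < B ->
  ('E_P[loss n s] <= B%:E)%E ->
  (forall m, M n m -> measurable (Bad m)) ->
  (forall m, M n m -> P (Bad m) <= (expR (- x m))%:E)%E ->
  (\esum_(m in M n) (expR (- x m))%:E <= q%:E)%E ->
  measurable Bad' -> (P Bad' <= ((1 - q) / 4)%:E)%E ->
  exists w m', [/\ M n m', forall m, M n m -> ~ Bad m w, ~ Bad' w,
    bias2 (@e m') s + noise2 (@e m') W w / n%:R <= 4 / (1 - q) * B &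
    forall m, M n m -> criterion lambda e n (observation W s n w) m' <=
                       criterion lambda e n (observation W s n w) m].
Proof.
move=> n0 cM q1 B0 EB mBad PBad xq mBad' PBad'.
have [Mhat mhat_meas ae_crit] := hmhat n0.
have [N [mN PN crit]] := ae_crit s.
have q0 : 0 < 1 - q by lra.
pose K := 4 / (1 - q) * B.
have K0 : 0 < K by rewrite mulr_gt0// divr_gt0.
have mr := measurable_loss s n0 cM.
pose A := [set w | K <= loss n s w].
have mA : measurable A.
  rewrite -[X in measurable X]setTI.
  exact: (measurable_fun_le measurableT (measurable_cst K) mr).
have PA : (P A <= ((1 - q) / 4)%:E)%E.
  rewrite unlock in EB; have := markov_ge0 K0 mr (fun w => sqr_ge0 _) EB.
  rewrite muleC -lee_pdivlMr// -EFinM => /le_trans; apply.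
  rewrite lee_fin [leLHS](_ : _ = (1 - q) / 4)//.
  by rewrite /K; field; rewrite !gt_eqF.
pose U := \bigcup_(m in M n) Bad m.
have mU : measurable U by exact: countable_bigcup_measurable.
have PU : (P U <= q%:E)%E.
  by apply: le_trans xq; exact: countable_union_bound.
have PV : (P (((U `|` Bad') `|` A) `|` N) < 1)%E.
  apply: (@le_lt_trans _ _ (P U + P Bad' + P A + P N))%E.
    apply: le_trans (measureU2 _ _ _) _ => //; first by do 2!apply: measurableU => //.
    rewrite leeD2r//; apply: le_trans (measureU2 _ _ _) _ => //.
      exact: measurableU.
    by rewrite leeD2r//; exact: measureU2.
  rewrite PN adde0; apply: (@le_lt_trans _ _ (q%:E + ((1 - q) / 4)%:E + ((1 - q) / 4)%:E)%E).
    by rewrite !leeD.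
  by rewrite -!EFinD lte_fin; lra.
have [w nw] : exists w, ~ (((U `|` Bad') `|` A) `|` N) w.
  apply: contrapT => /forallNP h.
  have VT : ((U `|` Bad') `|` A) `|` N = setT.
    by apply/seteqP; split => // w _; apply: contrapT; exact: h.
  by move: PV; rewrite VT probability_setT ltxx.
exists w, (mhat n (observation W s n w)); split => //.
- by move=> m Mm Bm; apply: nw; left; left; left; exists m.
- by move=> Bw; apply: nw; left; left; right.
- rewrite -(estimator_loss (he n0 (Mhat _)))//.
  rewrite leNgt; apply/negP => h; apply: nw; left; right.
  exact: ltW.
- by move=> m Mm; apply: contrapT => h; apply: nw; right; apply: crit => /= /(_ m Mm).
Qed.

(** The nonnegative term X(m) / n of the reference model has been dropped. *)
Lemma criterion_comparison n s w m m' : (0 < n)%N -> M n m -> M n m' ->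
  criterion lambda e n (observation W s n w) m' <=
  criterion lambda e n (observation W s n w) m ->
  bias2 (@e m') s + lambda n / n%:R * (model_dim m')%:R <=
  bias2 (@e m) s + lambda n / n%:R * (model_dim m)%:R +
  2 / Num.sqrt n%:R * bias_noise (@e m') W s w
  + 2 / Num.sqrt n%:R * - bias_noise (@e m) W s w
  + noise2 (@e m') W w / n%:R.
Proof.
move=> n0 Mm Mm'; rewrite /criterion /penalty.
rewrite (criterion_value (he n0 Mm))// (criterion_value (he n0 Mm'))//.
have : 0 <= noise2 (@e m) W w / n%:R by rewrite divr_ge0// noise2_ge0.
set X' := noise2 (@e m') W w / _; set X1 := noise2 (@e m) W w / _.
set c := 2 / _; set eps := lambda n / _.
set g := bias_noise (@e m) W s w; set g' := bias_noise (@e m') W s w.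
set b := bias2 (@e m) s; set b' := bias2 (@e m') s.
clearbody X' X1 c eps g g' b b'; rewrite !mulrDr mulrN => X10.
by lra.
Qed.

End selected_model.

(** * Model selection on a good outcome *)

Section selected_model.
Context {R : realType} {d} {X : measurableType d}.
Variable mu : {measure set X -> \bar R}.
Context {d'} {T : measurableType d'} {P : probability T R}.
Variable W : L2 mu -> {RV P >-> R}.
Hypothesis hW : white_noise W.
Variable M : nat -> set (set (L2 mu)).
Variable e : forall m : set (L2 mu), 'I_(model_dim m) -> L2 mu.
Hypothesis he : forall n m, (0 < n)%N -> M n m -> orthonormal_basis (@e m) m.
Variable lambda : nat -> R.
Variable mhat : nat -> (L2 mu -> R) -> set (L2 mu).
Hypothesis hmhat : selection_rule W M lambda e mhat.

(** Turns the exponential deviation bound at c = A r, where r = sqrt n, into a bound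
    on the cross term of [criterion_comparison]. *)
Lemma bias_noise_control (A r g b x : R) : 0 < A -> 0 < r ->
  (A * r) * g - (A * r) ^+ 2 * b / 2 < x ->
  2 / r * g <= 2 * x / (A * r ^+ 2) + A * b.
Proof.
move=> A0 r0 h; rewrite -lerBlDr.
have -> : 2 / r * g - A * b =
    2 * ((A * r) * g - (A * r) ^+ 2 * b / 2) / (A * r ^+ 2).
  by field; rewrite !gt_eqF.
by rewrite ler_pM2r ?invr_gt0 ?mulr_gt0 ?exprn_gt0// ler_pM2l// ltW.
Qed.

Lemma le_esum_subset (I : choiceType) (A B : set I) (a : I -> \bar R) :
  A `<=` B -> (\esum_(i in A) a i <= \esum_(i in B) a i)%E.
Proof.
move=> AB; apply: ge_ereal_sup => _ [F [finF FA] <-].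
apply: ereal_sup_ubound; exists F => //; split => //.
exact: subset_trans AB.
Qed.

(** The small loss bounds the quadratic noise on the selected model, and on the good
    outcome the quadratic noise dominates the dimension.  The constant does not
    involve s. *)
Lemma initial_model n s (q B kappa : R) :
  (0 < n)%N -> countable (M n) -> q < 1 -> 0 < B ->
  ('E_P[loss W e mhat n s] <= B%:E)%E -> 0 <= lambda n ->
  (\esum_(m in M n) (expR (- (kappa * (model_dim m)%:R)))%:E <= q%:E)%E ->
  exists2 m, M n m &
    bias2 (@e m) s + lambda n / n%:R * (model_dim m)%:R <=
    (1 + expR (kappa + 1) ^+ 2 / 2 * lambda n) * (4 / (1 - q) * B).
Proof.
move=> n0 cM q1 B0 EB l0 sq.
pose t := expR (kappa + 1) ^+ 2 / 2.
have t0 : 0 < t by rewrite divr_gt0// exprn_gt0// expR_gt0.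
pose Bad (m : set (L2 mu)) := [set w | t * noise2 (@e m) W w <= (model_dim m)%:R].
have mBad m : M n m -> measurable (Bad m).
  move=> Mm; rewrite -[X in measurable X]setTI.
  apply: measurable_fun_le => //; apply: measurable_funM => //.
  exact: measurable_noise2.
have PBad m : M n m ->
    (P (Bad m) <= (expR (- (kappa * (model_dim m)%:R)))%:E)%E.
  by move=> Mm; apply: (noise2_small_ball (he n0 Mm)).
have q4 : (P set0 <= ((1 - q) / 4)%:E)%E.
  by rewrite measure0 lee_fin divr_ge0// subr_ge0 ltW.
have [w [m [Mm nBad _ lossB _]]] :=
  good_outcome he hmhat n0 cM q1 B0 EB mBad PBad sq measurable0 q4.
exists m => //; rewrite -/t.
have /negP := nBad m Mm; rewrite -ltNge => Dt.
have b0 := bias2_ge0 (@e m) s.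
have X0 := noise2_ge0 (@e m) W w.
have n_gt0 : 0 < n%:R :> R by rewrite ltr0n.
apply: le_trans (_ : bias2 (@e m) s + lambda n / n%:R * (t * noise2 (@e m) W w) <= _).
  by rewrite lerD2l ler_wpM2l ?divr_ge0// ltW.
have -> : lambda n / n%:R * (t * noise2 (@e m) W w) =
    t * lambda n * (noise2 (@e m) W w / n%:R) by field; rewrite gt_eqF.
have Y0 : 0 <= noise2 (@e m) W w / n%:R by rewrite divr_ge0// ltW.
have tl0 : 0 <= t * lambda n by rewrite mulr_ge0// ltW.
by move: lossB Y0 b0 tl0; move: (_ / n%:R) (4 / _ * _) (bias2 _ _) (t * _) => y Q b l; nra.
Qed.

(** The weight (sqrt lambda - 1)^2 D / 2 is at most kappa lambda D / 2, so the deviation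
    bound with A = kappa / theta costs theta eps D(m') and A b(m'), and the latter is
    controlled by the loss.  For the reference model the same bound is used with
    A = theta and a fixed level L, which costs theta b(m) and a term of order 1 / n. *)
Lemma refined_model n s (q B kappa theta L : R) m :
  (0 < n)%N -> countable (M n) -> q < 1 -> 0 < B ->
  ('E_P[loss W e mhat n s] <= B%:E)%E -> 0 < lambda n ->
  0 < theta -> 0 < kappa -> (Num.sqrt (lambda n) - 1) ^+ 2 <= kappa * lambda n ->
  expR (- L) <= (1 - q) / 4 ->
  (\esum_(m in M n)
     (expR (- ((Num.sqrt (lambda n) - 1) ^+ 2 * (model_dim m)%:R / 2)))%:E
    <= q%:E)%E ->
  M n m ->
  exists m', [/\ M n m', bias2 (@e m') s <= 4 / (1 - q) * B &
    (1 - theta) * (bias2 (@e m') s + lambda n / n%:R * (model_dim m')%:R) <=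
    (1 + theta) * (bias2 (@e m) s + lambda n / n%:R * (model_dim m)%:R)
    + (kappa / theta + 1) * (4 / (1 - q) * B) + 2 * L / (theta * n%:R)].
Proof.
move=> n0 cM q1 B0 EB l0 th0 k0 lk Lq sq Mm.
have n_gt0 : 0 < n%:R :> R by rewrite ltr0n.
pose r : R := Num.sqrt n%:R; have r0 : 0 < r by rewrite sqrtr_gt0.
have r2 : r ^+ 2 = n%:R by rewrite sqr_sqrtr// ltW.
pose A := kappa / theta; have A0 : 0 < A by rewrite divr_gt0.
pose x (m : set (L2 mu)) : R := (Num.sqrt (lambda n) - 1) ^+ 2 * (model_dim m)%:R / 2.
pose Bad (m : set (L2 mu)) := [set w | x m <= A * r * bias_noise (@e m) W s w -
  (A * r) ^+ 2 * bias2 (@e m) s / 2].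
have mtail (c y : R) (m1 : set (L2 mu)) : measurable [set w | y <= c * bias_noise (@e m1) W s w -
    c ^+ 2 * bias2 (@e m1) s / 2].
  rewrite -[X in measurable X]setTI.
  apply: measurable_fun_le => //; apply: measurable_funB => //.
  by apply: measurable_funM => //; exact: measurable_bias_noise.
(* The sign is reversed for the reference model, whose noise must not be too negative. *)
pose Bad' := [set w | L <= - (theta * r) * bias_noise (@e m) W s w -
  (- (theta * r)) ^+ 2 * bias2 (@e m) s / 2].
have PBad m1 : M n m1 -> (P (Bad m1) <= (expR (- x m1))%:E)%E.
  by move=> Mm1; exact: bias_noise_tail.
have PBad' : (P Bad' <= ((1 - q) / 4)%:E)%E.
  apply: le_trans (_ : (expR (- L))%:E <= _)%E; last by rewrite lee_fin.
  exact: bias_noise_tail.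
have [w [m' [Mm' nBad nBad' lossB crit]]] :=
  good_outcome he hmhat n0 cM q1 B0 EB (fun m1 _ => mtail _ _ m1) PBad sq
   (mtail _ _ m) PBad'.
have X0 := noise2_ge0 (@e m') W w.
have Y0 : 0 <= noise2 (@e m') W w / n%:R by rewrite divr_ge0// ltW.
exists m'; split => //.
  by apply: le_trans lossB; rewrite lerDl.
have comp := criterion_comparison he n0 Mm Mm' (crit m Mm).
have /negP := nBad m' Mm'; rewrite -ltNge => /(bias_noise_control A0 r0) h1.
have /negP := nBad'; rewrite -ltNge sqrrN mulNr -mulrN.
move=> /(bias_noise_control th0 r0) h2.
have h3 : 2 * x m' / (A * r ^+ 2) <=
    theta * (lambda n / n%:R * (model_dim m')%:R).
  have -> : theta * (lambda n / n%:R * (model_dim m')%:R) =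
      2 * (kappa * lambda n * (model_dim m')%:R / 2) / (A * r ^+ 2).
    by rewrite r2 /A; field; rewrite !gt_eqF.
  have Ar0 : 0 < (A * r ^+ 2)^-1 by rewrite invr_gt0 pmulr_rgt0 ?exprn_gt0.
  rewrite ler_pM2r// ler_pM2l// /x.
  by rewrite ler_pM2r// ler_wpM2r.
rewrite -/r in comp.
rewrite r2 in h2; rewrite -/A.
have ed0 : 0 <= lambda n / n%:R * (model_dim m)%:R.
  by rewrite mulr_ge0// divr_ge0// ltW.
move: comp h1 h2 h3 lossB Y0 ed0.
have := bias2_ge0 (@e m') s; have := bias2_ge0 (@e m) s.
move: (2 * x m' / _) (2 * L / _) (_ / n%:R * (model_dim m)%:R)
  (_ / n%:R * (model_dim m')%:R) (noise2 _ _ _ / _) (4 / _ * _)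
  (2 / r * _) (2 / r * _) (bias2 (@e m) s) (bias2 (@e m') s).
move=> xx ll ed ed' y Q g' g b b' b0 b'0 comp h1 h2 h3 lossB Y0 ed0.
have : A * b' <= A * Q - A * y by rewrite -mulrBr ler_pM2l//; lra.
have : 0 <= A * y by rewrite mulr_ge0// ltW.
have : 0 <= theta * ed by rewrite mulr_ge0// ltW.
have : 0 <= theta * b' by rewrite mulr_ge0// ltW.
by lra.
Qed.

End selected_model.

(** * Transporting the approximation rate along dyadic sample sizes *)

Section powers.
Context {R : realType}.

(** Here x^beta - x = x^beta (1 - x^(1 - beta)), where x^beta >= x >= 1 / 2 and
    x^(1 - beta) <= (1 - delta)^(1 - beta). *)
Lemma powR_gap (beta delta x : R) : 0 < beta < 1 -> 0 < delta ->
  2^-1 <= x <= 1 - delta ->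
  x + 2^-1 * (1 - (1 - delta) `^ (1 - beta)) <= x `^ beta.
Proof.
move=> /andP[b0 b1] d0 /andP[x2 xd].
have x0 : 0 < x by apply: lt_le_trans x2; rewrite invr_gt0.
have xE : x = x `^ beta * x `^ (1 - beta).
  rewrite -powRD ?subrKC ?powRr1 ?ltW//.
  by rewrite gt_eqF// implybT.
have xb : x `^ (1 - beta) <= (1 - delta) `^ (1 - beta).
  by rewrite ge0_ler_powR ?nnegrE; lra.
have d1 : (1 - delta) `^ (1 - beta) <= 1.
  have e1 : (1 : R) `^ (1 - beta) = 1 by rewrite powR1.
  by rewrite -[leRHS]e1 ge0_ler_powR ?nnegrE; lra.
have xbx : x <= x `^ beta.
  by rewrite {1}xE ler_piMr ?powR_ge0// (le_trans xb).
move: xE xb d1 xbx; move: (x `^ beta) (x `^ _) ((1 - delta) `^ _) => u v w.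
by move=> xE xb d1 xbx; nra.
Qed.

Lemma powR_gap_gt0 (beta delta : R) : beta < 1 -> 0 < delta -> delta <= 2^-1 ->
  0 < 2^-1 * (1 - (1 - delta) `^ (1 - beta)) < 1.
Proof.
move=> b1 d0 d2.
have : (1 - delta) `^ (1 - beta) < 1.
  have e1 : (1 : R) `^ (1 - beta) = 1 by rewrite powR1.
  by rewrite -[ltRHS]e1 gt0_ltr_powR ?nnegrE; lra.
have := powR_ge0 (1 - delta) (1 - beta).
by move: (_ `^ _) => u; lra.
Qed.

Lemma rho_sq (lambda : nat -> R) n alpha :
  rho lambda n alpha ^+ 2 = (lambda n / n%:R) `^ (2 * (alpha / (1 + 2 * alpha))).
Proof. by rewrite /rho -powR_mulrn ?powR_ge0// -powRrM (mulrC _ 2). Qed.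

End powers.
(** Writes b + x ed as (1 - x) b + x (b + ed).  With theta = gamma / 8, the ratio
    (1 + theta) / (1 - theta) is at most 1 + gamma / 2, and the other half of the gap
    gamma absorbs the terms that do not contain C. *)
Lemma refinement_arith {R : realType} (x gamma C G K v b ed : R) :
  0 < gamma < 1 -> 0 <= x <= 1 -> 0 <= v -> 0 <= b -> 0 <= C -> 0 <= G ->
  2 * (K + 2 * G) <= C * gamma -> b <= K * v ->
  (1 - gamma / 8) * (b + ed) <= (1 + gamma / 8) * (C * v) + G * v ->
  b + x * ed <= (x + gamma) * (C * v).
Proof.
move=> /andP[g0 g1] /andP[x0 x1] v0 b0 C0 G0 KG hb hed.
have Cv0 : 0 <= C * v by exact: mulr_ge0.
have Gv0 : 0 <= G * v by exact: mulr_ge0.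
have {KG}KGv : 2 * (K * v + 2 * (G * v)) <= gamma * (C * v).
  have -> : 2 * (K * v + 2 * (G * v)) = 2 * (K + 2 * G) * v by ring.
  by rewrite mulrCA mulrA ler_wpM2r// mulrC.
have {hed}hed : b + ed <= (1 + gamma / 2) * (C * v) + 2 * (G * v).
  have g8 : 0 < 1 - gamma / 8 by lra.
  rewrite -(ler_pM2l g8) (le_trans hed)//.
  move: (C * v) (G * v) Cv0 Gv0 => c w c0 w0.
  have h1 : 0 <= c * (gamma * (4 - gamma)).
    by rewrite mulr_ge0// mulr_ge0; lra.
  have h2 : 0 <= w * (4 - gamma) by rewrite mulr_ge0//; lra.
  by lra.
move: (K * v) (C * v) (G * v) Cv0 Gv0 KGv hb hed.
move=> k c w c0 w0 kw bk hed.
have -> : b + x * ed = (1 - x) * b + x * (b + ed) by ring.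
have k0 : 0 <= k by apply: le_trans bk.
have h1 : (1 - x) * b <= k.
  by apply: le_trans bk; rewrite ler_piMl// gerBl.
have h2 : x * (b + ed) <= x * ((1 + gamma / 2) * c + 2 * w) by rewrite ler_wpM2l.
have h3 : x * (gamma * c) <= gamma * c.
  by rewrite ler_piMl// mulr_ge0// ltW.
have h4 : x * w <= w by rewrite ler_piMl.
by lra.
Qed.

Section approximation_rate.
Context {R : realType} {d} {X : measurableType d}.
Variable mu : {measure set X -> \bar R}.
Context {d'} {T : measurableType d'} {P : probability T R}.
Variable W : L2 mu -> {RV P >-> R}.
Hypothesis hW : white_noise W.
Variable M : nat -> set (set (L2 mu)).
Variable e : forall m : set (L2 mu), 'I_(model_dim m) -> L2 mu.
Hypothesis he : forall n m, (0 < n)%N -> M n m -> orthonormal_basis (@e m) m.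
Variable lambda : nat -> R.
Variable mhat : nat -> (L2 mu -> R) -> set (L2 mu).
Hypothesis hmhat : selection_rule W M lambda e mhat.


Variable s : L2 mu.

(** With beta = 2 alpha / (1 + 2 alpha) this is the square of [rho lambda n alpha]. *)
Definition rate (beta : R) (n : nat) : R := (lambda n / n%:R) `^ beta.

(** A witness for the bound on the infimum over the collection; a witness, unlike the
    infimum, can be fed to the selection argument. *)
Definition approximable (beta C : R) (n : nat) : Prop :=
  exists2 m, M n m &
    bias2 (@e m) s + lambda n / n%:R * (model_dim m)%:R <= C * rate beta n.

(** The constant G collects what [refined_model] adds to (1 + theta) C rate: the bound on
    the loss, and 2 L / (theta n), which is a multiple of eps n because lambda n >=
    lambda n0, hence of the rate because eps n <= eps n0. *)
Lemma approximable_double (n n0 : nat) (q r kappa L beta delta C G : R) :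
  let gamma := 2^-1 * (1 - (1 - delta) `^ (1 - beta)) in
  (0 < n)%N -> countable (M n) -> q < 1 -> 0 < r -> 0 < beta < 1 ->
  0 < delta -> delta <= 2^-1 -> 0 < kappa -> 0 <= L -> 0 < lambda n0 ->
  (0 < n0)%N ->
  M n `<=` M (2 * n)%N -> 0 < lambda n -> lambda n0 <= lambda n ->
  lambda n <= lambda (2 * n)%N -> lambda (2 * n)%N <= 2 * (1 - delta) * lambda n ->
  lambda n / n%:R <= lambda n0 / n0%:R ->
  ('E_P[loss W e mhat n s] <= (r * rate beta n)%:E)%E ->
  (Num.sqrt (lambda n) - 1) ^+ 2 <= kappa * lambda n ->
  expR (- L) <= (1 - q) / 4 ->
  (\esum_(m in M n)
     (expR (- ((Num.sqrt (lambda n) - 1) ^+ 2 * (model_dim m)%:R / 2)))%:E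
    <= q%:E)%E ->
  0 <= C ->
  G = (kappa / (gamma / 8) + 1) * (4 / (1 - q) * r) +
      2 * L / (gamma / 8 * lambda n0) * (lambda n0 / n0%:R) `^ (1 - beta) ->
  2 * (4 / (1 - q) * r + 2 * G) <= C * gamma ->
  approximable beta C n -> approximable beta C (2 * n)%N.
Proof.
move=> gamma n1 cM q1 r0 /andP[b0 b1] d0 d2 k0 L0 ln0 n0_gt0 MM ln l0n l2n ld en EB
  lk Lq sq C0 GE CG [m Mm hm].
have /andP[g0 g1] : 0 < gamma < 1 by exact: powR_gap_gt0.
have th0 : 0 < gamma / 8 by rewrite divr_gt0.
have nR : 0 < n%:R :> R by rewrite ltr0n.
have n0R : 0 < n0%:R :> R by rewrite ltr0n.
have e0 : 0 < lambda n / n%:R by rewrite divr_gt0.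
have v0 : 0 < rate beta n by exact: powR_gt0.
have K0 : 0 < 4 / (1 - q) * r by rewrite mulr_gt0// divr_gt0// subr_gt0.
have x2 : 2^-1 <= lambda (2 * n)%N / (2 * lambda n).
  by rewrite ler_pdivlMr ?mulr_gt0// mulrA mulVf// mul1r.
have xd : lambda (2 * n)%N / (2 * lambda n) <= 1 - delta.
  by rewrite ler_pdivrMr ?mulr_gt0// mulrA (mulrC (1 - delta)).
have eps2 : lambda (2 * n)%N / (2 * n)%:R =
    lambda (2 * n)%N / (2 * lambda n) * (lambda n / n%:R).
  by rewrite natrM; field; rewrite !gt_eqF.
move: (lambda (2 * n)%N / (2 * lambda n)) x2 xd eps2 => x x2 xd eps2.
have x0 : 0 <= x by apply: le_trans x2; rewrite invr_ge0.
have x1 : x <= 1 by apply: le_trans xd _; rewrite gerBl ltW.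
have rate2 : rate beta (2 * n) = x `^ beta * rate beta n.
  by rewrite /rate eps2 powRM// ltW.
have B0 : 0 < r * rate beta n by rewrite mulr_gt0.
have [m' [Mm' hb hr]] := refined_model hW he hmhat n1 cM q1 B0 EB ln th0 k0 lk
  Lq sq Mm.
rewrite (mulrA (4 / _) r) in hb hr.
exists m'; first exact: MM.
rewrite rate2 eps2 -mulrA.
apply: (@le_trans _ _ ((x + gamma) * (C * rate beta n))); last first.
  rewrite [leRHS]mulrCA ler_wpM2r ?mulr_ge0 ?(ltW v0)//.
  by apply: powR_gap => //; [rewrite b0 b1|rewrite x2 xd].
have F : 2 * L / (gamma / 8 * n%:R) <=
    2 * L / (gamma / 8 * lambda n0) * (lambda n0 / n0%:R) `^ (1 - beta)
      * rate beta n.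
  have eE : lambda n / n%:R <= (lambda n0 / n0%:R) `^ (1 - beta) * rate beta n.
    have {1}-> : lambda n / n%:R = (lambda n / n%:R) `^ (1 - beta) * rate beta n.
      rewrite -powRD ?subrK ?powRr1 ?ltW//.
      by rewrite gt_eqF// implybT.
    apply: ler_wpM2r; first exact: powR_ge0.
    apply: ge0_ler_powR => //; first by rewrite subr_ge0 ltW.
      by rewrite nnegrE ltW.
    by rewrite nnegrE divr_ge0 ?(ltW n0R) ?(ltW ln0).
  have -> : 2 * L / (gamma / 8 * n%:R) =
      2 * L / (gamma / 8 * lambda n) * (lambda n / n%:R).
    by field; rewrite !gt_eqF.
  have t0 : 0 < gamma / 8 * lambda n0 by exact: mulr_gt0.
  have tn : 0 < gamma / 8 * lambda n by exact: mulr_gt0.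
  have L20 : 0 <= 2 * L by rewrite mulr_ge0.
  rewrite -[leRHS]mulrA; apply: ler_pM; last exact: eE.
  - by rewrite divr_ge0// ltW.
  - exact: ltW.
  - by rewrite ler_wpM2l// lef_pV2 ?posrE// ler_pM2l.
have G0 : 0 <= G.
  rewrite GE; apply: addr_ge0; apply: mulr_ge0.
  - apply: addr_ge0 => //; apply: divr_ge0; exact: ltW.
  - exact: ltW.
  - apply: divr_ge0; first exact: mulr_ge0.
    exact: ltW (mulr_gt0 th0 ln0).
  - exact: powR_ge0.
apply: (@refinement_arith _ x gamma C G (4 / (1 - q) * r)) => //.
- by rewrite g0 g1.
- by rewrite x0 x1.
- exact: ltW.
- exact: bias2_ge0.
- apply: (le_trans hr); rewrite -addrA; apply: lerD.
    by rewrite ler_wpM2l// addr_ge0// ltW.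
  by rewrite GE [leRHS]mulrDl -(mulrA (kappa / _ + 1)) lerD2l.
Qed.

(** Between N and 2 N both the penalty and the rate change by a factor at most 2. *)
Lemma approximable_between (N n : nat) (beta C : R) : (0 < N)%N ->
  (N <= n <= 2 * N)%N -> M N `<=` M n -> 0 < lambda N -> lambda N <= lambda n ->
  lambda n <= 2 * lambda N -> 0 <= beta <= 1 -> 0 <= C ->
  approximable beta C N -> approximable beta (4 * C) n.
Proof.
move=> N0 /andP[Nn nN] MM lN l2 l1 /andP[b0 b1] C0 [m Mm hm].
exists m; first exact: MM.
have n0 : (0 < n)%N := leq_trans N0 Nn.
have NR : 0 < N%:R :> R by rewrite ltr0n.
have nR : 0 < n%:R :> R by rewrite ltr0n.
have ln : 0 < lambda n := lt_le_trans lN l2.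
have eN0 : 0 <= lambda N / N%:R by rewrite divr_ge0 ?ltW.
have en0 : 0 <= lambda n / n%:R by rewrite divr_ge0 ?ltW.
have e1 : lambda n / n%:R <= 2 * (lambda N / N%:R).
  rewrite mulrA ler_pM ?invr_ge0 ?(ltW nR) ?(ltW ln)//.
  by rewrite lef_pV2 ?posrE// ler_nat.
have e2 : lambda N / N%:R <= 2 * (lambda n / n%:R).
  rewrite mulrCA ler_pM ?invr_ge0 ?(ltW NR) ?(ltW lN)//.
  by rewrite ler_pdivlMr// mulrC ler_pdivrMr// -natrM ler_nat.
have rN : rate beta N <= 2 * rate beta n.
  apply: (@le_trans _ _ ((2 * (lambda n / n%:R)) `^ beta)).
    by apply: ge0_ler_powR; rewrite ?nnegrE// mulr_ge0.
  rewrite powRM// ler_wpM2r ?powR_ge0//.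
  by rewrite -[leRHS]powRr1// ler_powR// ler1n.
have D0 : 0 <= (model_dim m)%:R :> R by [].
have h1 : lambda n / n%:R * (model_dim m)%:R <=
    2 * (lambda N / N%:R * (model_dim m)%:R) by rewrite mulrA ler_wpM2r.
have h2 : C * rate beta N <= 2 * (C * rate beta n).
  by rewrite mulrCA ler_wpM2l.
rewrite -(mulrA 4); move: (C * rate beta N) (C * rate beta n) h1 h2 hm.
have := bias2_ge0 (@e m) s.
move: (bias2 _ _) (lambda n / _ * _) (lambda N / _ * _) => b u v b_ge0 c c' h1 h2 hm.
by lra.
Qed.

End approximation_rate.

(** * The maxiset theorem *)

Theorem theorem2 (R : realType) (D : set R) (mD : measurable D)
    (d : measure_display) (T : measurableType d) (P : probability T R)
    (W : L2 (lebesgue_on mD) -> {RV P >-> R}) (hW : white_noise W)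
    (I : countType) (phi : I -> L2 (lebesgue_on mD))
    (M : nat -> set (set (L2 (lebesgue_on mD))))
    (hM : forall n m, (0 < n)%N -> M n m -> is_model phi m)
    (e : forall m : set (L2 (lebesgue_on mD)), 'I_(model_dim m) -> L2 (lebesgue_on mD))
    (he : forall n m, (0 < n)%N -> M n m -> orthonormal_basis (e m) m)
    (lambda : nat -> R)
    (lambda_gt0 : forall n, (0 < n)%N -> 0 < lambda n)
    (mhat : nat -> (L2 (lebesgue_on mD) -> R) -> set (L2 (lebesgue_on mD)))
    (hmhat : selection_rule W M lambda e mhat)
    (alpha0 : R) (alpha0_gt0 : 0 < alpha0)
    (M_nested : forall n, (0 < n)%N -> M n `<=` M n.+1)
    (lambda_nondecr : forall n, (0 < n)%N -> lambda n <= lambda n.+1)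
    (lambda_lim : (fun n : nat => (n%:R)^-1 * lambda n) @ \oo --> (0 : R))
    (n0 : nat) (n0_gt0 : (0 < n0)%N)
    (delta : R) (delta_gt0 : 0 < delta) (delta_le : delta <= 2^-1)
    (p : R) (p_gt0 : 0 < p) (p_lt1 : p < 1)
    (lambda_double : forall n, (n0 <= n)%N ->
      lambda (2 * n)%N <= 2 * (1 - delta) * lambda n)
    (M_sum : forall n, (n0 <= n)%N ->
      (\esum_(m in M n)
         (expR (- ((Num.sqrt (lambda n) - 1) ^+ 2 * (model_dim m)%:R / 2)))%:E
       <= (Num.sqrt (1 - p))%:E)%E)
    (lambda_n0 : Upsilon delta p alpha0 <= lambda n0) :
  forall alpha : R, 0 < alpha -> alpha <= alpha0 ->
  forall r : R, 0 < r ->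
  exists r' : R, 0 < r' /\
    forall s : L2 (lebesgue_on mD),
      (ereal_sup [set ((rho lambda n alpha) ^- 2)%:E *
         'E_P[fun w : T =>
           (L2norm (selected_estimator e mhat n (observation W s n w) - s)
              ^+ 2)%R]
         | n in [set n | (0 < n)%N]] <= (r ^+ 2)%:E)%E ->
      (ereal_sup [set ((rho lambda n alpha) ^- 2)%:E * approx_error lambda M s n
         | n in [set n | (0 < n)%N]] <= (r' ^+ 2)%:E)%E.
Proof.
move=> alpha a0 _ r r0.
pose q := Num.sqrt (1 - p); pose beta := 2 * (alpha / (1 + 2 * alpha)).
have b0 : 0 < beta by rewrite mulr_gt0// divr_gt0// addr_gt0// mulr_gt0.
have b1 : beta < 1.
  by rewrite /beta mulrA ltr_pdivrMr ?mul1r ?ltrDr// addr_gt0// mulr_gt0.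
have q1 : q < 1 by rewrite -[ltRHS]sqrtr1 ltr_sqrt ?ltr01// gtrBl.
have rhoE n : rho lambda n alpha ^+ 2 = rate lambda beta n by rewrite rho_sq.
have eps0 n : (0 < n)%N -> 0 < lambda n / n%:R.
  by move=> n1; rewrite divr_gt0 ?lambda_gt0// ltr0n.
have rate0 n : (0 < n)%N -> 0 < rate lambda beta n.
  by move=> n1; rewrite powR_gt0// eps0.
have M_mono n n' : (0 < n)%N -> (n <= n')%N -> M n `<=` M n'.
  move=> n1 /subnK <-; elim: (_ - _)%N => [//|k IH].
  by apply: subset_trans IH _; apply: M_nested; rewrite addn_gt0 n1 orbT.
have lambda_mono n n' : (0 < n)%N -> (n <= n')%N -> lambda n <= lambda n'.
  move=> n1 /subnK <-; elim: (_ - _)%N => [//|k IH].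
  by apply: le_trans IH _; apply: lambda_nondecr; rewrite addn_gt0 n1 orbT.
have cM n : (n0 <= n)%N -> countable (M n).
  move=> n0n; apply: esum_bounded_countable (M_sum n n0n) => m _.
  exact: expR_gt0.
suff [C [C0 HC]] : exists C, 0 < C /\ forall s,
    (forall n, (0 < n)%N ->
      ('E_P[loss W e mhat n s] <= (r ^+ 2 * rate lambda beta n)%:E)%E) ->
    forall n, (0 < n)%N -> approximable M e lambda s beta C n.
  exists (Num.sqrt C); split; first by rewrite sqrtr_gt0.
  move=> s loss_le; rewrite (sqr_sqrtr (ltW C0)).
  apply: ge_ereal_sup => _ [n n1 <-].
  have [|m Mm tm] := HC s _ n n1.
    move=> k k1.
    have : (((rho lambda k alpha) ^- 2)%:E * 'E_P[loss W e mhat k s] <= (r ^+ 2)%:E)%E.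
      by apply: le_trans loss_le; apply: ereal_sup_ubound; exists k.
    by rewrite muleC lee_pdivrMr ?rhoE ?rate0// -EFinM.
  rewrite muleC lee_pdivrMr ?rhoE ?rate0// -EFinM.
  apply: (@le_trans _ _ (bias2 (e m) s + lambda n / n%:R * (model_dim m)%:R)%:E).
    apply: ereal_inf_lbound; exists m => //.
    by rewrite (orth_proj_bias (he n m n1 Mm)).
  by rewrite lee_fin.
have l0 := lambda_gt0 n0 n0_gt0.
(* kappa0 is the exponent of the weights at n0, kappa bounds (sqrt lambda - 1)^2 / lambda,
   C0 serves the sample sizes up to n0, and C is large enough to absorb G. *)
pose kappa0 := (Num.sqrt (lambda n0) - 1) ^+ 2 / 2.
pose t := expR (kappa0 + 1) ^+ 2 / 2.
pose gamma := 2^-1 * (1 - (1 - delta) `^ (1 - beta)).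
pose kappa := 1 + (lambda n0)^-1.
pose L := - ln ((1 - q) / 4).
pose K := 4 / (1 - q) * r ^+ 2.
pose G := (kappa / (gamma / 8) + 1) * K +
      2 * L / (gamma / 8 * lambda n0) * (lambda n0 / n0%:R) `^ (1 - beta).
pose C0 := (1 + t * lambda n0) * K.
pose C := C0 + 2 * (K + 2 * G) / gamma.
have r20 : 0 < r ^+ 2 by rewrite exprn_gt0.
have /andP[g0 g1] : 0 < gamma < 1 by exact: powR_gap_gt0.
have t0 : 0 < t by rewrite divr_gt0// exprn_gt0// expR_gt0.
have k0 : 0 < kappa by rewrite addr_gt0// invr_gt0.
have /andP[q40 q41] : 0 < (1 - q) / 4 < 1.
  have : 0 <= q by exact: sqrtr_ge0.
  by clear -q1; move: q q1 => q q1 q0; lra.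
have K0 : 0 < K by rewrite mulr_gt0// divr_gt0// subr_gt0.
have L0 : 0 <= L by rewrite oppr_ge0 ln_le0// ltW.
have Lq : expR (- L) <= (1 - q) / 4 by rewrite opprK lnK.
have C00 : 0 < C0 by rewrite mulr_gt0// addr_gt0// mulr_gt0.
have G0 : 0 <= G.
  apply: addr_ge0; apply: mulr_ge0.
  - apply: addr_ge0 => //; apply: divr_ge0; first exact: ltW.
    by rewrite divr_ge0// ltW.
  - exact: ltW.
  - apply: divr_ge0; first exact: mulr_ge0.
    by rewrite mulr_ge0 ?(ltW l0)// divr_ge0// ltW.
  - exact: powR_ge0.
have KG0 : 0 <= 2 * (K + 2 * G) by rewrite mulr_ge0// addr_ge0 ?(ltW K0)// mulr_ge0.
have C0C : C0 <= C by rewrite lerDl divr_ge0// ltW.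
have C1 : 0 < C := lt_le_trans C00 C0C.
have CG : 2 * (K + 2 * G) <= C * gamma.
  rewrite -[leLHS](divfK (lt0r_neq0 g0)) ler_wpM2r ?(ltW g0)//.
  by rewrite lerDr ltW.
exists (4 * C); split; first by rewrite mulr_gt0.
move=> s hs.
have base n : (0 < n)%N -> (n <= n0)%N -> approximable M e lambda s beta C n.
  move=> n1 nn0.
  have cMn : countable (M n).
    exact: sub_countable (subset_card_le (M_mono n n0 n1 nn0)) (cM n0 (leqnn _)).
  have B0 : 0 < r ^+ 2 * rate lambda beta n by rewrite mulr_gt0// rate0.
  have l0n : 0 <= lambda n by rewrite ltW// lambda_gt0.
  have sn : (\esum_(m in M n) (expR (- (kappa0 * (model_dim m)%:R)))%:E <= q%:E)%E.
    apply: le_trans (M_sum n0 (leqnn _)).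
    apply: le_trans (le_esum_subset _ (M_mono n n0 n1 nn0)) _.
    by apply: le_esum => m _; rewrite lee_fin ler_expR lerN2 /kappa0 mulrAC.
  have [m Mm hm] := initial_model hW he hmhat n1 cMn q1 B0 (hs n n1) l0n sn.
  exists m => //; apply: (le_trans hm).
  rewrite (mulrA (4 / _)) mulrA ler_wpM2r ?powR_ge0// (le_trans _ C0C)//.
  by rewrite ler_wpM2r ?(ltW K0)// lerD2l ler_wpM2l ?(ltW t0)// lambda_mono.
have dyadic j : let N := (2 ^ j * n0)%N in
    lambda N / N%:R <= lambda n0 / n0%:R /\ approximable M e lambda s beta C N.
  elim: j => [|j [IH1 IH2]]; first by rewrite mul1n; split => //; exact: base.
  have n0N : (n0 <= 2 ^ j * n0)%N by rewrite leq_pmull// expn_gt0.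
  rewrite /= expnS -mulnA; move: (2 ^ j * n0)%N n0N IH1 IH2 => n n0n en IH.
  have n1 : (0 < n)%N := leq_trans n0_gt0 n0n.
  have ln := lambda_gt0 n n1.
  have n2 : (n <= 2 * n)%N by rewrite leq_pmull.
  have l0n := lambda_mono n0 n n0_gt0 n0n.
  split.
    apply: le_trans en.
    rewrite natrM invfM mulrA ler_pM2r ?invr_gt0 ?ltr0n// ler_pdivrMr//.
    apply: (le_trans (lambda_double n n0n)).
    by rewrite mulrC ler_wpM2l ?(ltW ln)// ler_piMr// gerBl ltW.
  have lk : (Num.sqrt (lambda n) - 1) ^+ 2 <= kappa * lambda n.
    have : 1 <= (lambda n0)^-1 * lambda n by rewrite mulrC ler_pdivlMr// mul1r.
    have := sqrtr_ge0 (lambda n).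
    rewrite sqrrB1 sqr_sqrtr ?(ltW ln)// /kappa mulrDl mul1r => u0 v1.
    rewrite -addrA lerD2l; apply: le_trans v1.
    by rewrite gerDr oppr_le0 mulrn_wge0.
  apply: (approximable_double hW he hmhat n1 (cM n n0n) q1 r20 _ delta_gt0
    delta_le k0 L0 l0 n0_gt0 (M_mono _ _ n1 n2) ln l0n (lambda_mono _ _ n1 n2)
    (lambda_double n n0n) en (hs n n1) lk Lq (M_sum n n0n) (ltW C1) erefl CG IH).
  by rewrite b0 b1.
move=> n n1; have [nn0|n0n] := leqP n n0.
  have [m Mm hm] := base n n1 nn0; exists m => //; apply: le_trans hm _.
  by rewrite ler_wpM2r ?powR_ge0// ler_peMl ?(ltW C1)// ler1n.
(* The largest sample size of the form 2^j n0 not above n. *)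
pose N := (2 ^ trunc_log 2 (n %/ n0) * n0)%N.
have Nn : (N <= n)%N by rewrite -leq_divRL// trunc_logP// divn_gt0// ltnW.
have nN : (n <= 2 * N)%N.
  by rewrite ltnW// mulnA -expnS -ltn_divLR// trunc_log_ltn.
have N0 : (n0 <= N)%N by rewrite leq_pmull// expn_gt0.
have N1 : (0 < N)%N := leq_trans n0_gt0 N0.
have lN := lambda_gt0 N N1.
have l1 : lambda n <= 2 * lambda N.
  apply: (le_trans (lambda_mono n (2 * N)%N n1 nN)).
  apply: (le_trans (lambda_double N N0)).
  by rewrite ler_wpM2r ?(ltW lN)// ler_piMr// gerBl ltW.
apply: (approximable_between N1 _ (M_mono N n N1 Nn) lN (lambda_mono N n N1 Nn) l1
  _ (ltW C1) (dyadic _).2).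
  by rewrite Nn nN.
by rewrite !ltW.
Qed.
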